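(* Let $(\mathfrak g_1,\mathfrak g_2)$ be a matched pair of Lie algebras. Then, via the canonical action of $U(\mathfrak g_1)$ on $R(\mathfrak g_2)$ given by $(u\triangleright f)(v)=f(v\triangleleft u)$ and the coaction of $R(\mathfrak g_2)$ on $U(\mathfrak g_1)$ determined by $\blacktriangledown_{\rm Alg}:\mathfrak g_1\to\mathfrak g_1\otimes R(\mathfrak g_2)$, $\blacktriangledown_{\rm Alg}(X_i)=\sum_jX_j\otimes f^j_i$ with $v\triangleright X_i=\sum_jf^j_i(v)X_j$ for $v\in U(\mathfrak g_2)$, the pair $(U(\mathfrak g_1),R(\mathfrak g_2))$ is a matched pair of Hopf algebras.
   Context: Everything is over $\mathbb C$; Lie algebras are finite dimensional. Sweedler notation $\Delta(h)=h_{(1)}\otimes h_{(2)}$, right coactions $u\mapsto u_{<0>}\otimes u_{<1>}$. **Matched pair of Lie algebras.** $(\mathfrak g_1,\mathfrak g_2)$ is a matched pair if there are a left action $\triangleright:\mathfrak g_2\otimes\mathfrak g_1\to\mathfrak g_1$ and a right action $\triangleleft:\mathfrak g_2\otimes\mathfrak g_1\to\mathfrak g_2$ with $\zeta\triangleright[X,Y]=[\zeta\triangleright X,Y]+[X,\zeta\triangleright Y]+(\zeta\triangleleft X)\triangleright Y-(\zeta\triangleleft Y)\triangleright X$ and $[\zeta,\xi]\triangleleft X=[\zeta\triangleleft X,\xi]+[\zeta,\xi\triangleleft X]+\zeta\triangleleft(\xi\triangleright X)-\xi\triangleleft(\zeta\triangleright X)$. The double crossed sum $\mathfrak g_1\bowtie\mathfrak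 g_2$ is $\mathfrak g_1\oplus\mathfrak g_2$ with bracket $[X\oplus\zeta,Z\oplus\xi]=([X,Z]+\zeta\triangleright Z-\xi\triangleright X)\oplus([\zeta,\xi]+\zeta\triangleleft Z-\xi\triangleleft X)$. Multiplication $U(\mathfrak g_1)\otimes U(\mathfrak g_2)\to U(\mathfrak g_1\bowtie\mathfrak g_2)$ is bijective; for $v\in U(\mathfrak g_2)$, $u\in U(\mathfrak g_1)$ let $\Psi(v\otimes u)\in U(\mathfrak g_1)\otimes U(\mathfrak g_2)$ be the element mapped to the product $vu$, and put $v\triangleright u=(\mathrm{id}\otimes\varepsilon)\Psi(v\otimes u)\in U(\mathfrak g_1)$, $v\triangleleft u=(\varepsilon\otimes\mathrm{id})\Psi(v\otimes u)\in U(\mathfrak g_2)$. For $X\in\mathfrak g_1$, $v\triangleright X\in\mathfrak g_1$. $X_1,\dots,X_n$ denotes a basis of $\mathfrak g_1$. **$R(\mathfrak g)$** is the commutative Hopf algebra of representative functions: linear functionals on $U(\mathfrak g)$ whose kernel contains a finite codimensional ideal, with $(fg)(u)=f(u_{(1)})g(u_{(2)})$, unit $\varepsilon$, $\Delta(f)=\sum f'_i\otimes f''_i$ iff $f(u^1u^2)=\sum f_i'(u^1)f_i''(u^2)$, $\varepsilon(f)=f(1)$, $S(f)(u)=f(S(u))$. The functions $f^j_i$ belong to $R(\mathfrak g_2)$. **Extension of the coaction.** $\blacktriangledown_{\rm Alg}$ is extended to $\blacktriangledown:U(\mathfrak g_1)\to U(\mathfrak g_1)\otimes R(\mathfrak g_2)$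 by $\blacktriangledown(1)=1\otimes1$, $\blacktriangledown(uv)=u_{(1)<0>}v_{<0>}\otimes u_{(1)<1>}(u_{(2)}\triangleright v_{<1>})$. **Matched pair of Hopf algebras.** Hopf algebras $\mathcal U,\mathcal F$ form a matched pair if $\mathcal F$ is a left $\mathcal U$-module algebra, $\mathcal U$ is a right $\mathcal F$-comodule coalgebra ($u_{<0>(1)}\otimes u_{<0>(2)}\otimes u_{<1>}=u_{(1)<0>}\otimes u_{(2)<0>}\otimes u_{(1)<1>}u_{(2)<1>}$, $\varepsilon(u_{<0>})u_{<1>}=\varepsilon(u)1$), and for all $u,v\in\mathcal U$, $f\in\mathcal F$: $\varepsilon(u\triangleright f)=\varepsilon(u)\varepsilon(f)$; $\Delta(u\triangleright f)=u_{(1)<0>}\triangleright f_{(1)}\otimes u_{(1)<1>}(u_{(2)}\triangleright f_{(2)})$; $\blacktriangledown(1)=1\otimes1$; $\blacktriangledown(uv)=u_{(1)<0>}v_{<0>}\otimes u_{(1)<1>}(u_{(2)}\triangleright v_{<1>})$; $u_{(2)<0>}\otimes(u_{(1)}\triangleright f)u_{(2)<1>}=u_{(1)<0>}\otimes u_{(1)<1>}(u_{(2)}\triangleright f)$. *)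

(* Defs.v *)
From HB Require Import structures.
From mathcomp Require Import all_boot all_order all_algebra.
From mathcomp Require Import generic_quotient boolp classical_sets functions reals complex.
From mathcomp Require Import ring.

Set Implicit Arguments.
Unset Strict Implicit.
Unset Printing Implicit Defensive.

Import GRing.Theory.

Local Open Scope ring_scope.
Local Open Scope quotient_scope.

Notation is_bilinear f := (bilinear_for *:%R *:%R f).

Section LinearFacts.
Variables (K : fieldType) (V W Z : lmodType K).

Lemma linD (f : V -> W) : linear f -> {morph f : x y / x + y}.
Proof. by move=> lf x y; have := lf 1 x y; rewrite !scale1r. Qed.

Lemma lin0 (f : V -> W) : linear f -> f 0 = 0.
Proof.
by move=> lf; apply: (addrI (f 0)); rewrite -linD // !addr0.
Qed.

Lemma linZ (f : V -> W) : linear f -> forall c x, f (c *: x) = c *: f x.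
Proof. by move=> lf c x; have := lf c x 0; rewrite !addr0 lin0 // addr0. Qed.

Lemma linN (f : V -> W) : linear f -> {morph f : x / - x}.
Proof. by move=> lf x; rewrite -scaleN1r linZ // scaleN1r. Qed.

Lemma linB (f : V -> W) : linear f -> {morph f : x y / x - y}.
Proof. by move=> lf x y; rewrite linD // linN. Qed.

Lemma lin_sum (f : V -> W) : linear f -> forall I (r : seq I) (P : pred I) F,
  f (\sum_(i <- r | P i) F i) = \sum_(i <- r | P i) f (F i).
Proof.
move=> lf I r P F; apply: (big_morph f (linD lf) (lin0 lf)).
Qed.

Lemma linP (f : V -> W) :
  {morph f : x y / x + y} -> (forall c x, f (c *: x) = c *: f x) -> linear f.
Proof. by move=> fD fZ c x y; rewrite fD fZ. Qed.

Lemma sum_linear I (r : seq I) (P : pred I) (F : I -> V -> W) :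
  (forall i, linear (F i)) -> linear (fun x => \sum_(i <- r | P i) F i x).
Proof.
move=> lF c x y; rewrite scaler_sumr -big_split /=.
by apply: eq_bigr => i _; rewrite lF.
Qed.

Lemma comp_linear (f : W -> Z) (h : V -> W) :
  linear f -> linear h -> linear (fun x => f (h x)).
Proof. by move=> lf lh c x y; rewrite lh lf. Qed.

End LinearFacts.

Section Tensor.
Variables (K : fieldType) (V W : lmodType K).

Definition teval (Z : lmodType K) (b : V -> W -> Z) (s : seq (V * W)) : Z :=
  \sum_(x <- s) b x.1 x.2.

(* A list of pairs (v, w) stands for the sum of the v ⊗ w, and two lists
   denote the same tensor when no bilinear map distinguishes them. *)
Definition tens_eq : rel (seq (V * W)) := fun s t =>
  `[< forall (Z : lmodType K) (b : V -> W -> Z), is_bilinear b ->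
      teval b s = teval b t >].

Lemma tens_eq_refl : reflexive tens_eq.
Proof. by move=> s; apply/asboolP. Qed.

Lemma tens_eq_sym : symmetric tens_eq.
Proof.
by move=> s t; apply/asboolP/asboolP => h Z b /h ->.
Qed.

Lemma tens_eq_trans : transitive tens_eq.
Proof.
by move=> s t u /asboolP h1 /asboolP h2; apply/asboolP => Z b bb; rewrite h1 ?h2.
Qed.

Canonical tens_equiv := EquivRel tens_eq tens_eq_refl tens_eq_sym tens_eq_trans.

Definition tens : Type := {eq_quot tens_equiv}.
HB.instance Definition _ := Choice.on tens.
HB.instance Definition _ := EqQuotient.on tens.

(* Sweedler notation: F summed over a representation of t as a sum of pure
   tensors. The value only depends on t when F is bilinear. *)
Definition swd (Z : lmodType K) (t : tens) (F : V -> W -> Z) : Z := teval F (repr t).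

Definition tpure (v : V) (w : W) : tens := \pi_tens [:: (v, w)].

Lemma swd_pi (Z : lmodType K) (b : V -> W -> Z) s : is_bilinear b ->
  swd (\pi_tens s) b = teval b s.
Proof.
move=> bb; have : repr (\pi_tens s) = s %[mod tens] by rewrite reprK.
by move/eqquotP => /asboolP; apply.
Qed.

Lemma tensP (x y : tens) :
  (forall (Z : lmodType K) (b : V -> W -> Z), is_bilinear b -> swd x b = swd y b) -> x = y.
Proof.
move=> h; rewrite -[x]reprK -[y]reprK; apply/eqquotP/asboolP => Z b; exact: h.
Qed.

Let tadd (x y : tens) : tens := \pi_tens (repr x ++ repr y).
Let tscale (c : K) (x : tens) : tens := \pi_tens [seq (c *: p.1, p.2) | p <- repr x].

Let swd_add (Z : lmodType K) (b : V -> W -> Z) x y : is_bilinear b -> swd (tadd x y) b = swd x b + swd y b.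
Proof. by move=> bb; rewrite swd_pi // /teval big_cat. Qed.

Let swd_scale (Z : lmodType K) (b : V -> W -> Z) c x : is_bilinear b -> swd (tscale c x) b = c *: swd x b.
Proof.
move=> bb; rewrite swd_pi // /teval big_map scaler_sumr.
by apply: eq_bigr => p _ /=; rewrite (linZ (f := b^~ _) (bb.1 _)).
Qed.

Let swd_zero (Z : lmodType K) (b : V -> W -> Z) : is_bilinear b -> swd (\pi_tens [::]) b = 0.
Proof. by move=> bb; rewrite swd_pi // /teval big_nil. Qed.

Let taddA : associative tadd.
Proof. by move=> x y z; apply: tensP => Z b bb; rewrite !swd_add // addrA. Qed.
Let taddC : commutative tadd.
Proof. by move=> x y; apply: tensP => Z b bb; rewrite !swd_add // addrC. Qed.
Let tadd0 : left_id (\pi_tens [::]) tadd.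
Proof. by move=> x; apply: tensP => Z b bb; rewrite !swd_add // swd_zero // add0r. Qed.
Let taddN : left_inverse (\pi_tens [::]) (tscale (-1)) tadd.
Proof.
move=> x; apply: tensP => Z b bb.
by rewrite swd_add // swd_zero // swd_scale // scaleN1r addNr.
Qed.

HB.instance Definition _ := GRing.isZmodule.Build tens taddA taddC tadd0 taddN.

Let tscaleA a b x : tscale a (tscale b x) = tscale (a * b) x.
Proof. by apply: tensP => Z f bf; rewrite !swd_scale // scalerA. Qed.
Let tscale1 : left_id 1 tscale.
Proof. by move=> x; apply: tensP => Z f bf; rewrite !swd_scale // scale1r. Qed.
Let tscaleDr : right_distributive tscale +%R.
Proof.
by move=> a x y; apply: tensP => Z f bf; rewrite swd_scale // !swd_add // !swd_scale // scalerDr.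
Qed.
Let tscaleDl x : {morph tscale^~ x : a b / a + b}.
Proof.
by move=> a b; apply: tensP => Z f bf; rewrite swd_scale // !swd_add // !swd_scale // scalerDl.
Qed.

HB.instance Definition _ :=
  GRing.Zmodule_isLmodule.Build K tens tscaleA tscale1 tscaleDr tscaleDl.

Lemma swd_linear (Z : lmodType K) (b : V -> W -> Z) : is_bilinear b ->
  linear (fun t => swd t b).
Proof.
move=> bb; apply: linP => [x y|c x]; first exact: swd_add.
exact: swd_scale.
Qed.

Lemma swd_pure (Z : lmodType K) (b : V -> W -> Z) v w : is_bilinear b ->
  swd (tpure v w) b = b v w.
Proof. by move=> bb; rewrite swd_pi // /teval big_seq1. Qed.

Lemma tpure_bilinear : is_bilinear tpure.
Proof.
split=> u c x y; apply: tensP => Z b bb; rewrite (swd_linear bb) !swd_pure //.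
  by rewrite (bb.1 u).
by rewrite (bb.2 u).
Qed.

Lemma tpureDl v v' w : tpure (v + v') w = tpure v w + tpure v' w.
Proof. exact: (linD (f := tpure^~ w) (tpure_bilinear.1 w)). Qed.
Lemma tpureDr v w w' : tpure v (w + w') = tpure v w + tpure v w'.
Proof. exact: (linD (tpure_bilinear.2 v)). Qed.
Lemma tpureBl v v' w : tpure (v - v') w = tpure v w - tpure v' w.
Proof. exact: (linB (f := tpure^~ w) (tpure_bilinear.1 w)). Qed.
Lemma tpureBr v w w' : tpure v (w - w') = tpure v w - tpure v w'.
Proof. exact: (linB (tpure_bilinear.2 v)). Qed.
Lemma tpureNl v w : tpure (- v) w = - tpure v w.
Proof. exact: (linN (f := tpure^~ w) (tpure_bilinear.1 w)). Qed.
Lemma tpureNr v w : tpure v (- w) = - tpure v w.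
Proof. exact: (linN (tpure_bilinear.2 v)). Qed.
Lemma tpure_suml I (r : seq I) (F : I -> V) w :
  tpure (\sum_(i <- r) F i) w = \sum_(i <- r) tpure (F i) w.
Proof. exact: (lin_sum (f := tpure^~ w) (tpure_bilinear.1 w)). Qed.
Lemma tpureZl c v w : tpure (c *: v) w = c *: tpure v w.
Proof. exact: (linZ (f := tpure^~ w) (tpure_bilinear.1 w)). Qed.
Lemma tpureZr c v w : tpure v (c *: w) = c *: tpure v w.
Proof. exact: (linZ (tpure_bilinear.2 v)). Qed.

Lemma lin_swd (Z Z' : lmodType K) (f : Z -> Z') (F : V -> W -> Z) t : linear f ->
  f (swd t F) = swd t (fun v w => f (F v w)).
Proof. by move=> lf; rewrite /swd /teval lin_sum. Qed.

Lemma eq_swd (Z : lmodType K) (F G : V -> W -> Z) t :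
  (forall v w, F v w = G v w) -> swd t F = swd t G.
Proof. by move=> FG; apply: eq_bigr => p _; rewrite FG. Qed.

Lemma tens_sum (t : tens) : t = swd t tpure.
Proof.
apply: tensP => Z b bb; rewrite (lin_swd (f := fun t => swd t b)); last exact: swd_linear.
rewrite [LHS]/swd /teval; apply: eq_bigr => p _; by rewrite swd_pure.
Qed.

Lemma tens_ind (P : tens -> Prop) : P 0 ->
  (forall v w t, P t -> P (tpure v w + t)) -> forall t, P t.
Proof.
move=> P0 PS t; rewrite [t]tens_sum /swd /teval.
by elim: (repr t) => [|p s IH]; rewrite ?big_nil // big_cons; apply: PS.
Qed.

Lemma tens_ext (Z : lmodType K) (f h : tens -> Z) : linear f -> linear h ->
  (forall v w, f (tpure v w) = h (tpure v w)) -> f =1 h.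
Proof.
move=> lf lh fh; elim/tens_ind => [|v w t IH]; first by rewrite !lin0.
by rewrite !linD // fh IH.
Qed.

Lemma swd_linearF (Y Z : lmodType K) (F : Y -> V -> W -> Z) t :
  (forall v w, linear (fun y => F y v w)) -> linear (fun y => swd t (F y)).
Proof. by move=> lF; apply: sum_linear => p; apply: lF. Qed.

End Tensor.

Arguments tens {K} V W.
Arguments tpure {K V W} v w.

Notation "v ⊗ w" := (tpure v w) (at level 40, left associativity) : ring_scope.
Notation "\sw_ ( a , b <- t ) E" := (swd t (fun a b => E))
  (at level 41, E at level 41, a name, b name, t at level 200,
   format "\sw_ ( a ,  b  <-  t )  E") : ring_scope.

Lemma swd_exchange (K : fieldType) (V W V' W' Z : lmodType K)
  (F : V -> W -> V' -> W' -> Z) (t : tens V W) (t' : tens V' W') :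
  \sw_(a, b <- t) \sw_(c, d <- t') F a b c d = \sw_(c, d <- t') \sw_(a, b <- t) F a b c d.
Proof. exact: exchange_big. Qed.


Section LinearTactic.
Variables (K : fieldType).

Lemma id_lin (V : lmodType K) : linear (fun x : V => x).
Proof. by []. Qed.

Lemma tpurel_lin (U V W : lmodType K) (f : U -> V) (w : W) :
  linear f -> linear (fun x => f x ⊗ w).
Proof. by move=> lf c x y; rewrite lf tpureDl tpureZl. Qed.

Lemma tpurer_lin (U V W : lmodType K) (f : U -> W) (v : V) :
  linear f -> linear (fun x => v ⊗ f x).
Proof. by move=> lf c x y; rewrite lf tpureDr tpureZr. Qed.

Lemma mull_lin (U : lmodType K) (A : algType K) (f : U -> A) (a : A) :
  linear f -> linear (fun x => f x * a).
Proof. by move=> lf c x y; rewrite lf mulrDl scalerAl. Qed.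

Lemma mulr_lin (U : lmodType K) (A : algType K) (f : U -> A) (a : A) :
  linear f -> linear (fun x => a * f x).
Proof. by move=> lf c x y; rewrite lf mulrDr scalerAr. Qed.

Lemma scalel_lin (U V : lmodType K) (f : U -> K) (v : V) :
  scalar f -> linear (fun x => f x *: v).
Proof. by move=> lf c x y; rewrite lf scalerDl scalerA. Qed.

Lemma scaler_lin (U V : lmodType K) (f : U -> V) (c : K) :
  linear f -> linear (fun x => c *: f x).
Proof. by move=> lf a x y; rewrite lf scalerDr !scalerA mulrC. Qed.

Lemma swdt_lin (U V W Z : lmodType K) (f : U -> tens V W) (b : V -> W -> Z) :
  linear f -> is_bilinear b -> linear (fun x => swd (f x) b).
Proof. by move=> lf bb c x y; rewrite lf (swd_linear bb). Qed.

End LinearTactic.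

Ltac lin := intros;
  first
    [ assumption
    | match goal with H : _ |- _ => apply H end
    | apply: id_lin
    | apply: tpurel_lin; lin | apply: tpurer_lin; lin
    | apply: mull_lin; lin | apply: mulr_lin; lin
    | apply: scalel_lin; lin | apply: scaler_lin; lin
    | (apply: swd_linearF => ? ?); lin
    | apply: swdt_lin; [lin | split; lin]
    | match goal with H : _ |- _ => apply: (comp_linear H); lin end ].
Ltac bilin := split; lin.

Section TensorAlgebra.
Variables (K : fieldType) (A B : algType K).

Let tmul (x y : tens A B) : tens A B :=
  \sw_(a, b <- x) \sw_(c, d <- y) ((a * c) ⊗ (b * d)).

Let tmul_lin : is_bilinear tmul.
Proof. by split=> u; lin. Qed.

Let tmul_pure a b c d : tmul (a ⊗ b) (c ⊗ d) = (a * c) ⊗ (b * d).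
Proof. by rewrite /tmul !swd_pure //; bilin. Qed.

Let tmulDl : left_distributive tmul +%R.
Proof. by move=> x y z; rewrite (linD (f := tmul^~ z) (tmul_lin.1 z)). Qed.
Let tmulDr : right_distributive tmul +%R.
Proof. by move=> x y z; rewrite (linD (tmul_lin.2 x)). Qed.

Let tmulA : associative tmul.
Proof.
move=> x y z; elim/tens_ind: x => [|a b x IHx].
  by rewrite !(lin0 (f := tmul^~ _) (tmul_lin.1 _)).
rewrite !tmulDl IHx; congr (_ + _) => {IHx}; elim/tens_ind: y => [|c d y IHy].
  by rewrite (lin0 (f := tmul^~ z) (tmul_lin.1 z)) (lin0 (tmul_lin.2 _)) (lin0 (f := tmul^~ z) (tmul_lin.1 z)).
rewrite !(tmulDl, tmulDr) IHy; congr (_ + _) => {IHy}; elim/tens_ind: z => [|e f z IHz].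
  by rewrite !(lin0 (tmul_lin.2 _)).
by rewrite !(tmulDl, tmulDr) IHz !tmul_pure !mulrA.
Qed.

Let tmul1 : left_id (1 ⊗ 1) tmul.
Proof.
elim/tens_ind => [|a b x IHx]; first by rewrite (lin0 (tmul_lin.2 _)).
by rewrite tmulDr tmul_pure IHx !mul1r.
Qed.
Let tmulr1 : right_id (1 ⊗ 1) tmul.
Proof.
elim/tens_ind => [|a b x IHx]; first by rewrite (lin0 (f := tmul^~ _) (tmul_lin.1 _)).
by rewrite tmulDl tmul_pure IHx !mulr1.
Qed.

HB.instance Definition _ :=
  GRing.Zmodule_isPzRing.Build (tens A B) tmulA tmul1 tmulr1 tmulDl tmulDr.

Lemma tens1 : 1 = 1 ⊗ 1 :> tens A B.
Proof. by []. Qed.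

Lemma tensM a b c d : (a ⊗ b) * (c ⊗ d) = (a * c) ⊗ (b * d) :> tens A B.
Proof. exact: tmul_pure. Qed.

Lemma tens_scalerAl c (x y : tens A B) : c *: (x * y) = (c *: x) * y.
Proof. exact: esym (linZ (f := tmul^~ y) (tmul_lin.1 y) c x). Qed.

Lemma tens_scalerAr c (x y : tens A B) : c *: (x * y) = x * (c *: y).
Proof. exact: esym (linZ (tmul_lin.2 x) c y). Qed.

Lemma tens_mult (C : pzRingType) (f : tens A B -> C) :
  {morph f : x y / x + y} ->
  (forall a b c d, f ((a * c) ⊗ (b * d)) = f (a ⊗ b) * f (c ⊗ d)) ->
  {morph f : x y / x * y}.
Proof.
move=> fD fM x y.
have f0 : f 0 = 0 by apply: (addrI (f 0)); rewrite -fD !addr0.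
elim/tens_ind: x => [|a b x IHx]; first by rewrite !mul0r f0 mul0r.
rewrite mulrDl !fD mulrDl IHx; congr (_ + _) => {IHx}.
elim/tens_ind: y => [|c d y IHy]; first by rewrite !mulr0 f0 mulr0.
by rewrite mulrDr !fD mulrDr IHy tensM fM.
Qed.

End TensorAlgebra.

Section Converse.
Variables (K : fieldType) (A : algType K).
HB.instance Definition _ := GRing.Lmodule.copy (A^c)%type A.
HB.instance Definition _ := GRing.Lmodule_isLalgebra.Build K (A^c)%type
  (fun a (u v : A) => scalerAr a v u).
HB.instance Definition _ := GRing.Lalgebra_isAlgebra.Build K (A^c)%type
  (fun a (u v : A) => scalerAl a v u).
End Converse.


HB.mixin Record Vector_isLieAlgebra (K : fieldType) g of Vector K g := {
  lie : g -> g -> g;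
  lie_bilinear : is_bilinear lie;
  liexx : forall x, lie x x = 0;
  lie_jacobi : forall x y z, lie x (lie y z) + lie y (lie z x) + lie z (lie x y) = 0
}.

(* Finite-dimensional Lie algebras over K. *)
#[short(type="lieAlgType")]
HB.structure Definition LieAlgebra (K : fieldType) :=
  { g of Vector K g & Vector_isLieAlgebra K g }.

Lemma lieC (K : fieldType) (g : lieAlgType K) (x y : g) : lie y x = - lie x y.
Proof.
have := liexx (x + y).
rewrite (linD (lie_bilinear.2 _)) !(linD (f := (@lie K g)^~ _) (lie_bilinear.1 _)).
by rewrite !liexx add0r addr0 => /eqP; rewrite addrC addr_eq0 => /eqP ->; rewrite opprK.
Qed.

(* Linear maps from g to an associative algebra carrying brackets to commutators. *)
Definition lie_map (K : fieldType) (g : lieAlgType K) (A : algType K) (f : g -> A) : Prop :=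
  linear f /\ forall x y, f (lie x y) = f x * f y - f y * f x.

Section Enveloping.
Variables (K : fieldType) (g : lieAlgType K).

(* A list of pairs (c, [:: x1; ...; xk]) stands for the sum of the
   noncommutative monomials c x1 ... xk. *)
Definition ueval (A : algType K) (f : g -> A) (s : seq (K * seq g)) : A :=
  \sum_(x <- s) x.1 *: \prod_(y <- x.2) f y.

(* Two noncommutative polynomials in g are identified when they agree in every
   algebra to which g maps by a lie_map, that is, modulo the ideal imposing
   linearity in g and x y - y x = [x, y]. The universal property is Ulift_spec
   and Ulift_uniq. *)
Definition u_eq : rel (seq (K * seq g)) := fun s t =>
  `[< forall (A : algType K) (f : g -> A), lie_map f -> ueval f s = ueval f t >].

Lemma u_eq_refl : reflexive u_eq.
Proof. by move=> s; apply/asboolP. Qed.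

Lemma u_eq_sym : symmetric u_eq.
Proof. by move=> s t; apply/asboolP/asboolP => h A f /h ->. Qed.

Lemma u_eq_trans : transitive u_eq.
Proof.
by move=> s t u /asboolP h1 /asboolP h2; apply/asboolP => A f lf; rewrite h1 ?h2.
Qed.

Canonical u_equiv := EquivRel u_eq u_eq_refl u_eq_sym u_eq_trans.

Definition Uenv : Type := {eq_quot u_equiv}.
HB.instance Definition _ := Choice.on Uenv.
HB.instance Definition _ := EqQuotient.on Uenv.

(* The algebra morphism Uenv -> A extending a lie_map f. *)
Definition Ulift (A : algType K) (f : g -> A) (u : Uenv) : A := ueval f (repr u).

Definition Uin (x : g) : Uenv := \pi_Uenv [:: (1, [:: x])].

Let Ulift_pi (A : algType K) (f : g -> A) s : lie_map f ->
  Ulift f (\pi_Uenv s) = ueval f s.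
Proof.
move=> lf; have : repr (\pi_Uenv s) = s %[mod Uenv] by rewrite reprK.
by move/eqquotP => /asboolP; apply.
Qed.

Lemma UenvP (x y : Uenv) :
  (forall (A : algType K) (f : g -> A), lie_map f -> Ulift f x = Ulift f y) -> x = y.
Proof.
move=> h; rewrite -[x]reprK -[y]reprK; apply/eqquotP/asboolP => A f; exact: h.
Qed.

Let uadd (x y : Uenv) : Uenv := \pi_Uenv (repr x ++ repr y).
Let uscale (c : K) (x : Uenv) : Uenv := \pi_Uenv [seq (c * p.1, p.2) | p <- repr x].
Let umul (x y : Uenv) : Uenv :=
  \pi_Uenv [seq (p.1 * q.1, p.2 ++ q.2) | p <- repr x, q <- repr y].
Let u0 : Uenv := \pi_Uenv [::].
Let u1 : Uenv := \pi_Uenv [:: (1, [::])].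

Section Lift.
Variables (A : algType K) (f : g -> A) (lf : lie_map f).

Let UliftD x y : Ulift f (uadd x y) = Ulift f x + Ulift f y.
Proof. by rewrite Ulift_pi // /ueval big_cat. Qed.
Let UliftZ c x : Ulift f (uscale c x) = c *: Ulift f x.
Proof.
rewrite Ulift_pi // /ueval big_map scaler_sumr.
by apply: eq_bigr => p _ /=; rewrite scalerA.
Qed.
Let UliftM x y : Ulift f (umul x y) = Ulift f x * Ulift f y.
Proof.
rewrite Ulift_pi // /ueval big_allpairs_dep mulr_suml.
apply: eq_bigr => p _ /=; rewrite mulr_sumr.
by apply: eq_bigr => q _ /=; rewrite big_cat -scalerAr -scalerAl scalerA mulrC.
Qed.
Let Ulift0 : Ulift f u0 = 0.
Proof. by rewrite Ulift_pi // /ueval big_nil. Qed.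
Let Ulift1 : Ulift f u1 = 1.
Proof. by rewrite Ulift_pi // /ueval big_seq1 big_nil scale1r. Qed.
Definition Ulift_ops := (UliftD, UliftZ, UliftM, Ulift0, Ulift1).
End Lift.

Let UE := Ulift_ops.

Let uaddA : associative uadd.
Proof. by move=> x y z; apply: UenvP => A f lf; rewrite !UE // addrA. Qed.
Let uaddC : commutative uadd.
Proof. by move=> x y; apply: UenvP => A f lf; rewrite !UE // addrC. Qed.
Let uadd0 : left_id u0 uadd.
Proof. by move=> x; apply: UenvP => A f lf; rewrite !UE // add0r. Qed.
Let uaddN : left_inverse u0 (uscale (-1)) uadd.
Proof. by move=> x; apply: UenvP => A f lf; rewrite !UE // scaleN1r addNr. Qed.

HB.instance Definition _ := GRing.isZmodule.Build Uenv uaddA uaddC uadd0 uaddN.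

Let uscaleA a b x : uscale a (uscale b x) = uscale (a * b) x.
Proof. by apply: UenvP => A f lf; rewrite !UE // scalerA. Qed.
Let uscale1 : left_id 1 uscale.
Proof. by move=> x; apply: UenvP => A f lf; rewrite !UE // scale1r. Qed.
Let uscaleDr : right_distributive uscale +%R.
Proof. by move=> a x y; apply: UenvP => A f lf; rewrite !UE // scalerDr. Qed.
Let uscaleDl x : {morph uscale^~ x : a b / a + b}.
Proof. by move=> a b; apply: UenvP => A f lf; rewrite !UE // scalerDl. Qed.

HB.instance Definition _ :=
  GRing.Zmodule_isLmodule.Build K Uenv uscaleA uscale1 uscaleDr uscaleDl.

Let umulA : associative umul.
Proof. by move=> x y z; apply: UenvP => A f lf; rewrite !UE // mulrA. Qed.
Let umul1 : left_id u1 umul.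
Proof. by move=> x; apply: UenvP => A f lf; rewrite !UE // mul1r. Qed.
Let umulr1 : right_id u1 umul.
Proof. by move=> x; apply: UenvP => A f lf; rewrite !UE // mulr1. Qed.
Let umulDl : left_distributive umul +%R.
Proof. by move=> x y z; apply: UenvP => A f lf; rewrite !UE // mulrDl. Qed.
Let umulDr : right_distributive umul +%R.
Proof. by move=> x y z; apply: UenvP => A f lf; rewrite !UE // mulrDr. Qed.
Let u1_neq0 : u1 != 0.
Proof.
apply/eqP => /(congr1 (Ulift (fun _ => 0 : K^o))).
have lf : lie_map (fun _ : g => 0 : K^o).
  by split=> [c x y|x y]; rewrite ?scaler0 ?addr0 ?mul0r ?subr0.
by rewrite !UE // => /eqP; rewrite oner_eq0.
Qed.

HB.instance Definition _ :=
  GRing.Zmodule_isNzRing.Build Uenv umulA umul1 umulr1 umulDl umulDr u1_neq0.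

Let uscaleAl (a : K) (u v : Uenv) : a *: (u * v) = (a *: u) * v.
Proof. by apply: UenvP => A f lf; rewrite !UE // scalerAl. Qed.
HB.instance Definition _ := GRing.Lmodule_isLalgebra.Build K Uenv uscaleAl.
Let uscaleAr (a : K) (u v : Uenv) : a *: (u * v) = u * (a *: v).
Proof. by apply: UenvP => A f lf; rewrite !UE // scalerAr. Qed.
HB.instance Definition _ := GRing.Lalgebra_isAlgebra.Build K Uenv uscaleAr.

Lemma UliftIn (A : algType K) (f : g -> A) x : lie_map f -> Ulift f (Uin x) = f x.
Proof. by move=> lf; rewrite Ulift_pi // /ueval !big_seq1 scale1r. Qed.

Lemma Ulift_lin (A : algType K) (f : g -> A) : lie_map f -> linear (Ulift f).
Proof. by move=> lf c x y; rewrite !UE. Qed.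

Lemma Ulift1 (A : algType K) (f : g -> A) : lie_map f -> Ulift f 1 = 1.
Proof. by move=> lf; rewrite UE. Qed.

Lemma UliftM (A : algType K) (f : g -> A) : lie_map f -> {morph Ulift f : x y / x * y}.
Proof. by move=> lf x y; rewrite UE. Qed.

Lemma Uin_lie_map : lie_map Uin.
Proof.
split=> [c x y|x y]; apply: UenvP => A f lf.
  by rewrite !UE // !UliftIn // lf.1.
have NE z : Ulift f (- z) = - Ulift f z by exact: (linN (Ulift_lin lf)).
by rewrite !(UE, NE) // !UliftIn // lf.2 scaleN1r.
Qed.

Let pi_sum (s : seq (K * seq g)) :
  \pi_Uenv s = \sum_(x <- s) x.1 *: \prod_(y <- x.2) Uin y.
Proof.
apply: UenvP => A f lf; rewrite Ulift_pi // (lin_sum (Ulift_lin lf)).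
apply: eq_bigr => p _; rewrite (linZ (Ulift_lin lf)); congr (_ *: _).
elim: p.2 => [|y w IH]; first by rewrite !big_nil Ulift1.
by rewrite !big_cons UliftM // IH UliftIn.
Qed.

Lemma Uenv_ind (P : Uenv -> Prop) :
  P 0 -> (forall c u v, P u -> P v -> P (c *: u + v)) ->
  P 1 -> (forall x u, P u -> P (Uin x * u)) -> forall u, P u.
Proof.
move=> P0 PL P1 PX u; rewrite -[u]reprK pi_sum.
elim: (repr u) => [|p s IH]; rewrite ?big_nil // big_cons; apply: PL => //.
by elim: p.2 => [|y w IHw]; rewrite ?big_nil // big_cons; apply: PX.
Qed.

Lemma Uenv_indr (P : Uenv -> Prop) :
  P 0 -> (forall c u v, P u -> P v -> P (c *: u + v)) ->
  P 1 -> (forall x u, P u -> P (u * Uin x)) -> forall u, P u.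
Proof.
move=> P0 PL P1 PX u; rewrite -[u]reprK pi_sum.
elim: (repr u) => [|p s IH]; rewrite ?big_nil // big_cons; apply: PL => //.
elim/last_ind: p.2 => [|w y IHw]; rewrite ?big_nil //.
by rewrite -cats1 big_cat /= big_seq1; apply: PX.
Qed.

Lemma Ulift_spec (A : algType K) (f : g -> A) : lie_map f ->
  [/\ linear (Ulift f), Ulift f 1 = 1, {morph Ulift f : u v / u * v}
    & forall x, Ulift f (Uin x) = f x].
Proof.
move=> lf; split; [exact: Ulift_lin | exact: Ulift1 | exact: UliftM |].
by move=> x; exact: UliftIn.
Qed.

Lemma Ulift_uniq (A : algType K) (F G : Uenv -> A) :
  linear F -> linear G -> F 1 = 1 -> G 1 = 1 ->
  {morph F : u v / u * v} -> {morph G : u v / u * v} ->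
  (forall x, F (Uin x) = G (Uin x)) -> F =1 G.
Proof.
move=> lF lG F1 G1 FM GM FGx; elim/Uenv_ind => [|c u v IHu IHv||x u IHu].
- by rewrite !lin0.
- by rewrite lF lG IHu IHv.
- by rewrite F1 G1.
- by rewrite FM GM FGx IHu.
Qed.

End Enveloping.


HB.mixin Record Algebra_isHopf (K : fieldType) H of GRing.Algebra K H := {
  comul : H -> tens H H;
  counit : H -> K;
  antipode : H -> H;
  comul_linear : linear comul;
  counit_linear : scalar counit;
  antipode_linear : linear antipode;
  comul1 : comul 1 = 1 ⊗ 1;
  comulM : forall x y, comul (x * y) = comul x * comul y;
  counit1 : counit 1 = 1;
  counitM : forall x y, counit (x * y) = counit x * counit y;
  comulA : forall h,
    \sw_(a, b <- comul h) \sw_(c, d <- comul a) (c ⊗ d ⊗ b) =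
    \sw_(a, b <- comul h) \sw_(c, d <- comul b) (a ⊗ c ⊗ d);
  counitl : forall h, \sw_(a, b <- comul h) (counit a *: b) = h;
  counitr : forall h, \sw_(a, b <- comul h) (counit b *: a) = h;
  antipodel : forall h, \sw_(a, b <- comul h) (antipode a * b) = (counit h)%:A;
  antipoder : forall h, \sw_(a, b <- comul h) (a * antipode b) = (counit h)%:A
}.

#[short(type="hopfAlgType")]
HB.structure Definition HopfAlgebra (K : fieldType) :=
  { H of GRing.Algebra K H & Algebra_isHopf K H }.

Section EnvelopingHopf.
Variables (K : fieldType) (g : lieAlgType K).
Local Notation U := (Uenv g).

Lemma zero_lie_map : lie_map (fun _ : g => 0 : K^o).
Proof. by split=> [c x y|x y]; rewrite ?scaler0 ?addr0 ?mul0r ?subr0. Qed.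

Definition Ucounit : U -> K := Ulift (fun _ : g => 0 : K^o).

Let eps_lin : scalar Ucounit. Proof. exact: Ulift_lin zero_lie_map. Qed.
Let eps1 : Ucounit 1 = 1. Proof. exact: Ulift1 zero_lie_map. Qed.
Let epsM x y : Ucounit (x * y) = Ucounit x * Ucounit y.
Proof. exact: (UliftM zero_lie_map). Qed.
Let epsX x : Ucounit (Uin x) = 0. Proof. exact: (UliftIn _ zero_lie_map). Qed.

Let tensU_neq0 : 1 != 0 :> tens U U.
Proof.
apply/eqP => /(congr1 (fun t => \sw_(a, b <- t) ((Ucounit a * Ucounit b) : K^o))).
have bb : is_bilinear (fun a b => (Ucounit a * Ucounit b) : K^o).
  split=> u c x y; rewrite eps_lin; first by rewrite mulrDl -mulrA.
  by rewrite mulrDr mulrCA.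
rewrite (lin0 (swd_linear bb)) tens1 swd_pure // eps1 mulr1.
by move/eqP; rewrite oner_eq0.
Qed.

HB.instance Definition _ := GRing.PzSemiRing_isNonZero.Build (tens U U) tensU_neq0.
HB.instance Definition _ :=
  GRing.Lmodule_isLalgebra.Build K (tens U U) (@tens_scalerAl K U U).
HB.instance Definition _ :=
  GRing.Lalgebra_isAlgebra.Build K (tens U U) (@tens_scalerAr K U U).

Let comm_aux (V : zmodType) (p q r s m n : V) :
  p - q + (r - s) = (p + m + (n + r)) - (q + n + (m + s)).
Proof.
rewrite [n + r]addrC [m + s]addrC [p + m + _]addrACA [q + n + _]addrACA.
rewrite [q + s + _]addrC [n + m]addrC.
by rewrite addrKA [LHS]addrACA -opprD.
Qed.

Lemma comul_lie_map : lie_map (fun x : g => Uin x ⊗ 1 + 1 ⊗ Uin x : tens U U).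
Proof.
have [lU cU] := Uin_lie_map g.
split=> [c x y|x y].
  by rewrite lU tpureDl tpureZl tpureDr tpureZr scalerDr addrACA.
rewrite cU !mulrDl !mulrDr !tensM !mul1r !mulr1 tpureBl tpureBr.
exact: comm_aux.
Qed.

Definition Ucomul : U -> tens U U := Ulift (fun x : g => Uin x ⊗ 1 + 1 ⊗ Uin x).

Lemma antipode_lie_map : lie_map (fun x : g => - Uin x : (U^c)%type).
Proof.
have [lU cU] := Uin_lie_map g.
split=> [c x y|x y]; first by rewrite lU opprD scalerN.
transitivity (- (Uin (lie x y)) : U) => //.
rewrite cU opprB.
change (Uin y * Uin x - Uin x * Uin y = (- Uin y) * (- Uin x) - (- Uin x) * (- Uin y) :> U).
by rewrite !mulrNN.
Qed.

(* The antipode is an algebra antimorphism: it is lifted to the converse algebra. *)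
Definition Uantipode : U -> U := Ulift (fun x : g => - Uin x : (U^c)%type).

Let D_lin : linear Ucomul. Proof. exact: Ulift_lin comul_lie_map. Qed.
Let D1 : Ucomul 1 = 1 ⊗ 1. Proof. exact: Ulift1 comul_lie_map. Qed.
Let DM x y : Ucomul (x * y) = Ucomul x * Ucomul y.
Proof. exact: (UliftM comul_lie_map). Qed.
Let DX x : Ucomul (Uin x) = Uin x ⊗ 1 + 1 ⊗ Uin x.
Proof. exact: (UliftIn _ comul_lie_map). Qed.

Let S_lin : linear Uantipode. Proof. exact: Ulift_lin antipode_lie_map. Qed.
Let S1 : Uantipode 1 = 1. Proof. exact: Ulift1 antipode_lie_map. Qed.
Let SM x y : Uantipode (x * y) = Uantipode y * Uantipode x.
Proof. exact: (UliftM antipode_lie_map). Qed.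
Let SX x : Uantipode (Uin x) = - Uin x.
Proof. exact: (UliftIn _ antipode_lie_map). Qed.

Let tl (t : tens U U) : tens (tens U U) U :=
  \sw_(a, b <- t) \sw_(c, d <- Ucomul a) (c ⊗ d ⊗ b).
Let ra (a : U) (t : tens U U) : tens (tens U U) U := \sw_(c, d <- t) (a ⊗ c ⊗ d).
Let tr (t : tens U U) : tens (tens U U) U := \sw_(a, b <- t) ra a (Ucomul b).
Let fl (t : tens U U) : tens U U := \sw_(a, b <- t) (b ⊗ a).
Let el (t : tens U U) : U := \sw_(a, b <- t) (Ucounit a *: b).
Let er (t : tens U U) : U := \sw_(a, b <- t) (Ucounit b *: a).
Let al (t : tens U U) : U := \sw_(a, b <- t) (Uantipode a * b).
Let ar (t : tens U U) : U := \sw_(a, b <- t) (a * Uantipode b).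

Let tl_lin : linear tl. Proof. by rewrite /tl; lin. Qed.
Let tr_lin : linear tr. Proof. by rewrite /tr /ra; lin. Qed.
Let fl_lin : linear fl. Proof. by rewrite /fl; lin. Qed.
Let el_lin : linear el. Proof. by rewrite /el; lin. Qed.
Let er_lin : linear er. Proof. by rewrite /er; lin. Qed.
Let al_lin : linear al. Proof. by rewrite /al; lin. Qed.
Let ar_lin : linear ar. Proof. by rewrite /ar; lin. Qed.
Let ra_lin a : linear (ra a). Proof. by rewrite /ra; lin. Qed.

Let tlp a b : tl (a ⊗ b) = Ucomul a ⊗ b.
Proof.
rewrite /tl swd_pure; last by bilin.
by rewrite [in RHS](tens_sum (Ucomul a)) (lin_swd (f := tpure^~ b)) //; lin.
Qed.
Let rap a b c : ra a (b ⊗ c) = a ⊗ b ⊗ c.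
Proof. by rewrite /ra swd_pure //; bilin. Qed.
Let trp a b : tr (a ⊗ b) = ra a (Ucomul b).
Proof. by rewrite /tr swd_pure //; rewrite /ra; bilin. Qed.
Let flp a b : fl (a ⊗ b) = b ⊗ a.
Proof. by rewrite /fl swd_pure //; bilin. Qed.
Let elp a b : el (a ⊗ b) = Ucounit a *: b.
Proof. by rewrite /el swd_pure //; bilin. Qed.
Let erp a b : er (a ⊗ b) = Ucounit b *: a.
Proof. by rewrite /er swd_pure //; bilin. Qed.
Let alp a b : al (a ⊗ b) = Uantipode a * b.
Proof. by rewrite /al swd_pure //; bilin. Qed.
Let arp a b : ar (a ⊗ b) = a * Uantipode b.
Proof. by rewrite /ar swd_pure //; bilin. Qed.

Let tlM : {morph tl : x y / x * y}.
Proof.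
apply: tens_mult => [|a b c d]; first exact: linD.
by rewrite !tlp DM tensM.
Qed.

Let raM a b s t : ra (a * b) (s * t) = ra a s * ra b t.
Proof.
elim/tens_ind: s => [|v w s IHs]; first by rewrite mul0r !(lin0 (ra_lin _)) mul0r.
rewrite mulrDl !(linD (ra_lin _)) mulrDl IHs; congr (_ + _) => {IHs}.
elim/tens_ind: t => [|v' w' t IHt]; first by rewrite mulr0 !(lin0 (ra_lin _)) mulr0.
rewrite mulrDr !(linD (ra_lin _)) mulrDr IHt; congr (_ + _).
by rewrite !(tensM, rap).
Qed.

Let trM : {morph tr : x y / x * y}.
Proof.
apply: tens_mult => [|a b c d]; first exact: linD.
by rewrite !trp DM raM.
Qed.

Let flM : {morph fl : x y / x * y}.
Proof.
by apply: tens_mult => [|a b c d]; [exact: linD | rewrite !flp tensM].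
Qed.
Let elM : {morph el : x y / x * y}.
Proof.
apply: tens_mult => [|a b c d]; first exact: linD.
by rewrite !elp epsM -scalerAl -scalerAr scalerA.
Qed.
Let erM : {morph er : x y / x * y}.
Proof.
apply: tens_mult => [|a b c d]; first exact: linD.
by rewrite !erp epsM -scalerAl -scalerAr scalerA.
Qed.

Let DA u : tl (Ucomul u) = tr (Ucomul u).
Proof.
elim/Uenv_ind: u => [|c u v IHu IHv||x u IHu].
- by rewrite !(lin0 D_lin, lin0 tl_lin, lin0 tr_lin).
- by rewrite D_lin tl_lin tr_lin IHu IHv.
- by rewrite D1 tlp trp D1 rap.
- rewrite DM tlM trM IHu; congr (_ * _).
  rewrite DX (linD tl_lin) (linD tr_lin) !tlp !trp DX D1 (linD (ra_lin _)) !rap.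
  by rewrite tpureDl addrA.
Qed.

Let UcomulC u : fl (Ucomul u) = Ucomul u.
Proof.
elim/Uenv_ind: u => [|c u v IHu IHv||x u IHu].
- by rewrite !(lin0 D_lin, lin0 fl_lin).
- by rewrite D_lin fl_lin IHu IHv.
- by rewrite D1 flp.
- by rewrite DM flM IHu DX (linD fl_lin) !flp addrC.
Qed.

Let elD u : el (Ucomul u) = u.
Proof.
elim/Uenv_ind: u => [|c u v IHu IHv||x u IHu].
- by rewrite !(lin0 D_lin, lin0 el_lin).
- by rewrite D_lin el_lin IHu IHv.
- by rewrite D1 elp eps1 scale1r.
- by rewrite DM elM IHu DX (linD el_lin) !elp epsX eps1 scale0r scale1r add0r.
Qed.

Let erD u : er (Ucomul u) = u.
Proof.
elim/Uenv_ind: u => [|c u v IHu IHv||x u IHu].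
- by rewrite !(lin0 D_lin, lin0 er_lin).
- by rewrite D_lin er_lin IHu IHv.
- by rewrite D1 erp eps1 scale1r.
- by rewrite DM erM IHu DX (linD er_lin) !erp epsX eps1 scale0r scale1r addr0.
Qed.

Let eps0 : Ucounit 0 = 0. Proof. exact: (lin0 (W := K^o) eps_lin). Qed.

Let alD u : al (Ucomul u) = (Ucounit u)%:A.
Proof.
elim/Uenv_ind: u => [|c u v IHu IHv||x u _].
- by rewrite (lin0 D_lin) (lin0 al_lin) eps0 scale0r.
- by rewrite D_lin al_lin IHu IHv eps_lin scalerDl scalerA.
- by rewrite D1 alp S1 eps1 mul1r scale1r.
- rewrite DM DX epsM epsX mul0r scale0r.
  elim/tens_ind: (Ucomul u) => [|v w t IH]; first by rewrite mulr0 (lin0 al_lin).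
  rewrite mulrDr (linD al_lin) IH addr0 mulrDl !tensM (linD al_lin) !alp.
  by rewrite !mul1r SM SX mulrN mulNr mulrA addNr.
Qed.

Let arD u : ar (Ucomul u) = (Ucounit u)%:A.
Proof.
elim/Uenv_indr: u => [|c u v IHu IHv||x u _].
- by rewrite (lin0 D_lin) (lin0 ar_lin) eps0 scale0r.
- by rewrite D_lin ar_lin IHu IHv eps_lin scalerDl scalerA.
- by rewrite D1 arp S1 eps1 mul1r scale1r.
- rewrite DM DX epsM epsX mulr0 scale0r.
  elim/tens_ind: (Ucomul u) => [|v w t IH]; first by rewrite mul0r (lin0 ar_lin).
  rewrite mulrDl (linD ar_lin) IH addr0 mulrDr !tensM (linD ar_lin) !arp.
  by rewrite !mulr1 SM SX mulNr mulrN mulrA addrN.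
Qed.

HB.instance Definition _ := Algebra_isHopf.Build K U
  D_lin eps_lin S_lin D1 DM eps1 epsM DA elD erD alD arD.

Lemma comulX x : comul (Uin x : U) = Uin x ⊗ 1 + 1 ⊗ Uin x.
Proof. exact: DX. Qed.
Lemma counitX x : counit (Uin x : U) = 0.
Proof. exact: epsX. Qed.
Lemma antipodeX x : antipode (Uin x : U) = - Uin x.
Proof. exact: SX. Qed.
Lemma antipode1 : antipode (1 : U) = 1.
Proof. exact: S1. Qed.
Lemma antipodeM (x y : U) : antipode (x * y) = antipode y * antipode x.
Proof. exact: SM. Qed.
Lemma comulC (u : U) : \sw_(a, b <- comul u) (b ⊗ a) = comul u.
Proof. exact: UcomulC. Qed.

End EnvelopingHopf.


Section ScalarFacts.
Variables (K : fieldType) (V : lmodType K) (f : V -> K) (fl : scalar f).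

Lemma scal_sum I (r : seq I) (P : pred I) (F : I -> V) :
  f (\sum_(i <- r | P i) F i) = \sum_(i <- r | P i) f (F i).
Proof. exact: (lin_sum (W := K^o) fl). Qed.
Lemma scal0 : f 0 = 0. Proof. exact: (lin0 (W := K^o) fl). Qed.
Lemma scalZ c v : f (c *: v) = c * f v. Proof. exact: (linZ (W := K^o) fl). Qed.
Lemma scalD : {morph f : x y / x + y}. Proof. exact: (linD (W := K^o) fl). Qed.
Lemma scalN : {morph f : x / - x}. Proof. exact: (linN (W := K^o) fl). Qed.
Lemma scalB : {morph f : x y / x - y}. Proof. exact: (linB (W := K^o) fl). Qed.

End ScalarFacts.

Section FiniteCodimension.
Variables (K : fieldType) (V : lmodType K).

Definition subspace (I : set V) : Prop :=
  I 0 /\ forall c x y, I x -> I y -> I (c *: x + y).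

Definition fin_codim (I : set V) : Prop :=
  exists n (s : 'I_n -> V), forall v, exists c : 'I_n -> K,
    I (v - \sum_(i < n) c i *: s i).

Lemma subspaceD I x y : subspace I -> I x -> I y -> I (x + y).
Proof. by move=> [_ h] ix iy; have := h 1 _ _ ix iy; rewrite scale1r. Qed.
Lemma subspaceZ I c x : subspace I -> I x -> I (c *: x).
Proof. by move=> [h0 h] ix; have := h c _ _ ix h0; rewrite addr0. Qed.
Lemma subspaceB I x y : subspace I -> I x -> I y -> I (x - y).
Proof.
by move=> sI ix iy; apply: subspaceD => //; rewrite -scaleN1r; apply: subspaceZ.
Qed.

Lemma fin_coord n (s : 'I_n -> V) (I : set V) : subspace I ->
  (forall v, exists c : 'I_n -> K, I (v - \sum_(i < n) c i *: s i)) ->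
  exists m (t : 'I_m -> V) (p : 'I_m -> V -> K),
    [/\ forall i, scalar (p i), forall i x, I x -> p i x = 0
      & forall v, I (v - \sum_(i < m) p i v *: t i)].
Proof.
elim: n s I => [|n IH] s I sI hs.
  exists 0%N, (fun _ => 0), (fun _ _ => 0); split=> [[]|[]|v] //.
  by have [c] := hs v; rewrite !big_ord0.
pose x := s ord0; pose J := [set v | exists c, I (v - c *: x)]%classic.
have sJ : subspace J.
  split=> [|c u v [a ha] [b hb]]; first by exists 0; rewrite scale0r subr0; exact: sI.1.
  exists (c * a + b); rewrite scalerDl -scalerA opprD addrACA -scalerBr.
  exact: sI.2.
have [|m [t [p [pl pJ hp]]]] := IH (fun i => s (lift ord0 i)) J sJ.
  move=> v; have [c hc] := hs v; exists (fun i => c (lift ord0 i)), (c ord0).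
  by move: hc; rewrite big_ord_recl opprD addrCA addrC -/x.
have IJ v : I v -> J v by exists 0; rewrite scale0r subr0.
case: (pselect (I x)) => [Ix|nIx].
  exists m, t, p; split=> // [i u /IJ|v]; first exact: pJ.
  have [c hc] := hp v.
  by rewrite -[X in I X](subrK (c *: x)); apply: subspaceD => //; apply: subspaceZ.
have [c hc] := choice hp.
have cU v d : I (v - \sum_(i < m) p i v *: t i - d *: x) -> d = c v.
  move=> hd; apply/eqP; case: eqVneq => // /eqP dc; case: nIx.
  have dcN : c v - d != 0 by rewrite subr_eq0 eq_sym; apply/eqP.
  have := subspaceB sI hd (hc v); rewrite opprB addrC addrA subrK -scalerBl.
  by move/(subspaceZ (c v - d)^-1 sI); rewrite scalerA mulVf ?scale1r.
exists m.+1, (fun i => if unlift ord0 i is Some j then t j else x),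
  (fun i => if unlift ord0 i is Some j then p j else c); split=> [i|i u Iu|v].
- case: (unlift ord0 i) => [j|]; first exact: pl.
  move=> a u v; apply/esym/cU.
  have -> : \sum_(i < m) p i (a *: u + v) *: t i =
      a *: (\sum_(i < m) p i u *: t i) + \sum_(i < m) p i v *: t i.
    rewrite scaler_sumr -big_split; apply: eq_bigr => k _.
    by rewrite pl scalerDl scalerA.
  rewrite scalerDl -scalerA opprD addrACA -scalerBr opprD addrACA -scalerBr.
  exact: sI.2.
- case: (unlift ord0 i) => [j|]; first exact/pJ/IJ.
  apply/esym/cU; rewrite scale0r subr0 big1 ?subr0 // => j _.
  by rewrite pJ ?scale0r //; apply: IJ.
- rewrite big_ord_recl unlift_none opprD addrCA addrC.
  by under eq_bigr => i _ do rewrite liftK; apply: hc.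
Qed.

Lemma fin_codim_sub (I J : set V) : (forall x, I x -> J x) -> fin_codim I -> fin_codim J.
Proof.
by move=> IJ [n [s hs]]; exists n, s => v; have [c hc] := hs v; exists c; apply: IJ.
Qed.

Lemma fin_codim_ord n (p : 'I_n -> V -> K) : (forall i, scalar (p i)) ->
  fin_codim [set v | forall i, p i v = 0]%classic.
Proof.
elim: n p => [|n IH] p pl; first by exists 0%N, (fun _ => 0) => v; exists (fun _ => 0) => - [].
pose I := [set v | forall i, p (lift ord0 i) v = 0]%classic.
have [m [s hs]] := IH (fun i => p (lift ord0 i)) (fun i => pl _).
have all_lift v : I v -> p ord0 v = 0 -> forall i, p i v = 0.
  by move=> Iv pv i; case: (unliftP ord0 i) => [j ->|->].
case: (pselect (exists2 x, I x & p ord0 x != 0)) => [[x Ix px]|nx]; last first.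
  exists m, s => v; have [c hc] := hs v; exists c; apply: all_lift => //.
  by apply/eqP/negPn/negP => h; apply: nx; exists (v - \sum_(i < m) c i *: s i).
exists m.+1, (fun i => if unlift ord0 i is Some j then s j else x) => v.
have [c hc] := hs v; set w := v - _ in hc.
exists (fun i => if unlift ord0 i is Some j then c j else p ord0 w / p ord0 x).
rewrite big_ord_recl unlift_none opprD addrCA addrC.
under eq_bigr => i _ do rewrite liftK.
rewrite -/w; apply: all_lift => [i|].
  rewrite (scalB (pl _)) (scalZ (pl _)).
  by rewrite (hc i : p _ w = 0) (Ix i : p _ x = 0) mulr0 subr0.
rewrite (scalB (pl _)) (scalZ (pl _)).
by apply/eqP; rewrite subr_eq0 eq_sym; apply/eqP; exact: divfK.
Qed.

Lemma fin_codim_ker (T : finType) (p : T -> V -> K) (J : set V) :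
  (forall i, scalar (p i)) -> (forall v, (forall i, p i v = 0) -> J v) -> fin_codim J.
Proof.
move=> pl pJ; apply: (fin_codim_sub _ (fin_codim_ord (fun i => pl (enum_val i)))).
by move=> v pv; apply: pJ => i; have := pv (enum_rank i); rewrite enum_rankK.
Qed.

End FiniteCodimension.

Section Representative.
Variables (K : fieldType) (g : lieAlgType K).
Local Notation U := (Uenv g).

Definition two_sided_ideal (I : set U) : Prop :=
  subspace I /\ forall a x, I x -> I (a * x) /\ I (x * a).

Definition representative (f : U -> K) : Prop :=
  scalar f /\ exists I : set U,
    [/\ two_sided_ideal I, fin_codim I & forall u, I u -> f u = 0].

(* The type R(g) of representative functions on U(g). *)
Record reprfun : Type := ReprFun {
  reprfun_val :> U -> K;
  reprfunP : representative reprfun_val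
}.
HB.instance Definition _ := gen_eqMixin reprfun.
HB.instance Definition _ := gen_choiceMixin reprfun.

Lemma reprfun_ext (f h : reprfun) : (forall u, f u = h u) -> f = h.
Proof.
case: f h => [f pf] [h ph] /= fh; have efh : f = h by apply/funext.
by subst h; congr ReprFun; apply: Prop_irrelevance.
Qed.

Lemma reprfun_lin (f : reprfun) : scalar f. Proof. by case: f => f []. Qed.
Lemma reprfun_linear (f : reprfun) : linear (f : U -> K^o). Proof. exact: reprfun_lin. Qed.

Lemma representative_zero : representative (fun _ => 0).
Proof.
split=> [c x y|]; first by rewrite mulr0 addr0.
exists setT; split=> //.
by apply: (@fin_codim_ker _ _ void (fun _ _ => 0)) => // -[].
Qed.

Lemma representative_coord (f : U -> K) : representative f ->
  exists I m (t : 'I_m -> U) (p : 'I_m -> U -> K),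
    [/\ two_sided_ideal I, forall u, I u -> f u = 0, forall i, scalar (p i),
        forall i x, I x -> p i x = 0
      & forall v, I (v - \sum_(i < m) p i v *: t i)].
Proof.
move=> [fl [I [iI [n [s hs]] fI]]].
by have [m [t [p [pl pI hp]]]] := fin_coord iI.1 hs; exists I, m, t, p.
Qed.

Lemma coord_mem (V : lmodType K) (I : set V) m (t : 'I_m -> V) (p : 'I_m -> V -> K) v :
  (forall v, I (v - \sum_(i < m) p i v *: t i)) -> (forall i, p i v = 0) -> I v.
Proof.
by move=> h pv; have := h v; rewrite big1 ?subr0 // => i _; rewrite pv scale0r.
Qed.

Lemma representative_lin c (f h : U -> K) : representative f -> representative h ->
  representative (fun u => c * f u + h u).
Proof.
move=> rf rh; split.
  move=> a x y; rewrite rf.1 rh.1 mulrDr addrACA mulrDr; congr (_ + _ + _).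
  by rewrite mulrCA.
have [I [m [t [p [iI fI pl pI hp]]]]] := representative_coord rf.
have [J [n [s [q [iJ hJ ql qJ hq]]]]] := representative_coord rh.
exists (I `&` J)%classic; split.
- split; first split; first by split; [exact: iI.1.1 | exact: iJ.1.1].
    by move=> a x y [? ?] [? ?]; split; [apply: iI.1.2 | apply: iJ.1.2].
  by move=> a x [/(iI.2 a)[? ?] /(iJ.2 a)[? ?]]; split; split.
- apply: (@fin_codim_ker _ _ ('I_m + 'I_n)%type
    (fun i => match i with inl i => p i | inr j => q j end)) => [[]|v pv] //.
  split; first by apply: (coord_mem hp) => i; exact: (pv (inl i)).
  by apply: (coord_mem hq) => i; exact: (pv (inr i)).
- by move=> u [/fI -> /hJ ->]; rewrite mulr0 addr0.
Qed.

Lemma representative_counit : representative (counit : U -> K).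
Proof.
have l : scalar (counit : U -> K) := @counit_linear K U.
split=> //; exists [set u | counit u = 0]%classic; split=> //.
- split; first split; first exact: (scal0 l).
    by move=> c x y /= hx hy; rewrite l hx hy mulr0 addr0.
  by move=> a x /= hx; rewrite !counitM hx mulr0 mul0r.
- by apply: (@fin_codim_ker _ _ unit (fun _ => counit)) => // v /(_ tt).
Qed.

Lemma representative_antipode (f : U -> K) : representative f ->
  representative (fun u => f (antipode u)).
Proof.
have Sl : linear (antipode : U -> U) := @antipode_linear K U.
move=> rf; split; first by move=> c x y; rewrite Sl rf.1.
have [I [m [t [p [iI fI pl pI hp]]]]] := representative_coord rf.
exists [set u | I (antipode u)]%classic; split.
- split; first split => [|c x y hx hy] /=; first by rewrite (lin0 Sl); exact: iI.1.1.
    by rewrite Sl; apply: iI.1.2.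
  by move=> a x /= hx; rewrite !antipodeM; have [] := iI.2 (antipode a) _ hx.
- apply: (@fin_codim_ker _ _ 'I_m (fun i u => p i (antipode u))) => [i c x y|v pv].
    by rewrite Sl pl.
  exact: (coord_mem hp).
- by move=> u /fI.
Qed.

(* The convolution product of functionals dual to the coproduct. *)
Definition conv (f h : U -> K) (u : U) : K := \sw_(a, b <- comul u) (f a * h b : K^o).

Lemma mulK_bilinear (V W : lmodType K) (f : V -> K) (h : W -> K) :
  scalar f -> scalar h -> is_bilinear (fun a b => f a * h b : K^o).
Proof.
move=> fl hl; split=> u c x y; first by rewrite fl mulrDl -mulrA.
by rewrite hl mulrDr mulrCA.
Qed.

Lemma conv_lin f h : scalar f -> scalar h -> scalar (conv f h).
Proof.
move=> fl hl c x y; rewrite /conv comul_linear.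
exact: (swd_linear (mulK_bilinear fl hl)).
Qed.

Lemma swd_mul (A B : algType K) (Z : lmodType K) (b : A -> B -> Z) (s t : tens A B) : is_bilinear b ->
  swd (s * t) b = \sw_(x, y <- s) \sw_(v, w <- t) b (x * v) (y * w).
Proof.
move=> bb.
rewrite [LHS](lin_swd (f := fun t => swd t b)); last exact: swd_linear.
apply: eq_swd => x y; rewrite (lin_swd (f := fun t => swd t b)); last exact: swd_linear.
by apply: eq_swd => v w; rewrite swd_pure.
Qed.

Lemma swd0 (V W Z : lmodType K) (t : tens V W) (F : V -> W -> Z) :
  (forall a b, F a b = 0) -> swd t F = 0.
Proof. by move=> F0; rewrite /swd /teval big1. Qed.

Lemma mull_scalar (f : U -> K) a : scalar f -> scalar (fun x => f (a * x)).
Proof. by move=> fl c x y; rewrite mulrDr -scalerAr fl. Qed.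
Lemma mulr_scalar (f : U -> K) a : scalar f -> scalar (fun x => f (x * a)).
Proof. by move=> fl c x y; rewrite mulrDl -scalerAl fl. Qed.

Lemma conv_mulE f h u v : scalar f -> scalar h ->
  conv f h (u * v) =
  \sw_(x, y <- comul u) \sw_(z, w <- comul v) (f (x * z) * h (y * w) : K^o).
Proof.
by move=> fl hl; rewrite /conv comulM swd_mul //; apply: mulK_bilinear.
Qed.

Lemma coord_expand (I : set U) m (t : 'I_m -> U) (p : 'I_m -> U -> K) (h : U -> K) v :
  (forall v, I (v - \sum_(i < m) p i v *: t i)) -> scalar h ->
  (forall x, I x -> h x = 0) -> h v = \sum_(i < m) p i v * h (t i).
Proof.
move=> hp hl hI; have := hI _ (hp v).
rewrite (scalB hl) (scal_sum hl) => /eqP; rewrite subr_eq0 => /eqP ->.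
by apply: eq_bigr => i _; rewrite (scalZ hl).
Qed.

Lemma representative_conv (f h : U -> K) : representative f -> representative h ->
  representative (conv f h).
Proof.
move=> rf rh; split; first exact: conv_lin rf.1 rh.1.
have [I [m [t [p [iI fI pl pI hp]]]]] := representative_coord rf.
have [J [n [s [q [iJ hJ ql qJ hq]]]]] := representative_coord rh.
pose L := [set u | forall k l, scalar k -> scalar l -> (forall x, I x -> k x = 0) ->
  (forall x, J x -> l x = 0) -> conv k l u = 0]%classic.
exists L; split.
- split; first split.
  + by move=> k l kl ll _ _; apply: (scal0 (conv_lin kl ll)).
  + move=> c x y Lx Ly k l kl ll kI lJ.
    by rewrite (conv_lin kl ll) Lx // Ly // mulr0 addr0.
  + move=> a x Lx; split=> k l kl ll kI lJ; rewrite conv_mulE //.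
      apply: (swd0 (Z := K^o)) => y z; apply: (Lx (fun w => k (y * w)) (fun w => l (z * w))).
      * exact: mull_scalar.
      * exact: mull_scalar.
      * by move=> w /(iI.2 y)[/kI].
      * by move=> w /(iJ.2 z)[/lJ].
    rewrite swd_exchange.
    apply: (swd0 (Z := K^o)) => y z; apply: (Lx (fun w => k (w * y)) (fun w => l (w * z))).
    * exact: mulr_scalar.
    * exact: mulr_scalar.
    * by move=> w /(iI.2 y)[_ /kI].
    * by move=> w /(iJ.2 z)[_ /lJ].
- apply: (@fin_codim_ker _ _ ('I_m * 'I_n)%type (fun ij => conv (p ij.1) (q ij.2))).
    by move=> ij; apply: conv_lin.
  move=> v pv k l kl ll kI lJ; rewrite /conv.
  rewrite (eq_swd (G := fun a b => \sum_i \sum_j (k (t i) * l (s j)) *: (p i a * q j b : K^o))).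
    rewrite /swd /teval exchange_big big1 // => i _.
    rewrite exchange_big big1 // => j _.
    rewrite -scaler_sumr; have := pv (i, j); rewrite /conv /swd /teval /= => ->.
    by rewrite scaler0.
  move=> a b; rewrite (coord_expand a hp kl kI) (coord_expand b hq ll lJ) mulr_suml.
  apply: eq_bigr => i _; rewrite mulr_sumr; apply: eq_bigr => j _.
  rewrite /GRing.scale /= mulrACA [RHS]mulrC; congr (_ * _).
- by move=> u; apply => //; [exact: rf.1 | exact: rh.1].
Qed.

End Representative.


Section Separation.
Variables (K : fieldType).

Lemma swd_mulKr (V W : lmodType K) (t : tens V W) (F : V -> W -> K^o) (k : K) :
  (swd t F : K) * k = \sw_(a, b <- t) (F a b * k : K^o).
Proof.
by apply: (lin_swd (f := fun x : K^o => (x * k : K^o))) => c x y; rewrite mulrDl -mulrA.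
Qed.

Lemma swd_mulKl (V W : lmodType K) (t : tens V W) (F : V -> W -> K^o) (k : K) :
  k * (swd t F : K) = \sw_(a, b <- t) (k * F a b : K^o).
Proof. by rewrite mulrC swd_mulKr; apply: (eq_swd (Z := K^o)) => a b; rewrite mulrC. Qed.

Variables (V W : lmodType K) (A B : Type) (e : V -> A -> K) (e' : W -> B -> K).
Hypothesis el : forall a, scalar (e^~ a).
Hypothesis e'l : forall b, scalar (e'^~ b).
Hypothesis e0 : forall v, (forall a, e v a = 0) -> v = 0.
Hypothesis e'0 : forall w, (forall b, e' w b = 0) -> w = 0.

Lemma tens_sep0 (t : tens V W) :
  (forall a b, (\sw_(v, w <- t) (e v a * e' w b : K^o)) = 0) -> t = 0.
Proof.
rewrite [t in t = 0]tens_sum /swd /teval; move: (repr t) => s {t}.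
elim: {s}(size s) {-2}s (erefl (size s)) => [|n IH] [|[v w] s] //= => [_ _|[sn] hs].
  by rewrite big_nil.
rewrite big_cons /=.
case: (pselect (exists b, e' w b != 0)) => [[b0 kb]|nb]; last first.
  have -> : w = 0.
    by apply: e'0 => b; apply/eqP/negPn/negP => h; apply: nb; exists b.
  rewrite -(scale0r (0 : W)) tpureZr scale0r add0r; apply: IH => // a b.
  have := hs a b; rewrite big_cons /= (_ : w = 0) ?(scal0 (e'l b)) ?mulr0 ?add0r //.
  by apply: e'0 => b'; apply/eqP/negPn/negP => h; apply: nb; exists b'.
pose c (p : V * W) := e' p.2 b0 / e' w b0.
have vE : v = - \sum_(p <- s) c p *: p.1.
  apply/eqP; rewrite -addr_eq0; apply/eqP/e0 => a.
  rewrite (scalD (el a)) (scal_sum (el a)).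
  apply: (mulIf kb); rewrite mul0r; apply: etrans (hs a b0); rewrite big_cons /= mulrDl; congr (_ + _).
  rewrite mulr_suml; apply: eq_bigr => p _.
  by rewrite (scalZ (el a)) /c mulrAC divfK // mulrC.
have -> : v ⊗ w + \sum_(p <- s) p.1 ⊗ p.2 =
    \sum_(p <- [seq (p.1, p.2 - c p *: w) | p <- s]) p.1 ⊗ p.2.
  rewrite big_map vE tpureNl tpure_suml addrC -sumrB.
  by apply: eq_bigr => p _; rewrite tpureBr tpureZr tpureZl.
apply: IH; first by rewrite size_map.
move=> a b; rewrite big_map /=; apply: etrans (hs a b); rewrite big_cons /=.
rewrite [in RHS]vE (scalN (el a)) (scal_sum (el a)) mulNr addrC.
rewrite mulr_suml -sumrB; apply: eq_bigr => p _.
rewrite (scalB (e'l b)) mulrBr; congr (_ - _).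
rewrite (scalZ (e'l b)) (scalZ (el a)).
by rewrite mulrCA mulrA.
Qed.

Lemma tens_sep (s t : tens V W) :
  (forall a b, (\sw_(v, w <- s) (e v a * e' w b : K^o)) =
               \sw_(v, w <- t) (e v a * e' w b : K^o)) -> s = t.
Proof.
move=> h; apply/eqP; rewrite -subr_eq0; apply/eqP/tens_sep0 => a b.
have bb := mulK_bilinear (el a) (e'l b).
by rewrite (linB (swd_linear bb)) h subrr.
Qed.

End Separation.

Section RepresentativeHopf.
Variables (K : fieldType) (g : lieAlgType K).
Local Notation U := (Uenv g).
Local Notation R := (reprfun g).

Let rep_add (f h : R) : representative (fun u => f u + h u).
Proof.
have := representative_lin 1 (reprfunP f) (reprfunP h).
by congr representative; apply/funext => u; rewrite mul1r.
Qed.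
Let rep_scale (c : K) (f : R) : representative (fun u => c * f u).
Proof.
have := representative_lin c (reprfunP f) (representative_zero g).
by congr representative; apply/funext => u; rewrite addr0.
Qed.

Let r0 : R := ReprFun (representative_zero g).
Let radd (f h : R) : R := ReprFun (rep_add f h).
Let rscale (c : K) (f : R) : R := ReprFun (rep_scale c f).

Let raddA : associative radd.
Proof. by move=> x y z; apply: reprfun_ext => u; apply: addrA. Qed.
Let raddC : commutative radd.
Proof. by move=> x y; apply: reprfun_ext => u; apply: addrC. Qed.
Let radd0 : left_id r0 radd.
Proof. by move=> x; apply: reprfun_ext => u; apply: add0r. Qed.
Let raddN : left_inverse r0 (rscale (-1)) radd.
Proof. by move=> x; apply: reprfun_ext => u /=; rewrite mulN1r addNr. Qed.
HB.instance Definition _ := GRing.isZmodule.Build R raddA raddC radd0 raddN.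

Let rscaleA a b x : rscale a (rscale b x) = rscale (a * b) x.
Proof. by apply: reprfun_ext => u /=; rewrite mulrA. Qed.
Let rscale1 : left_id 1 rscale.
Proof. by move=> x; apply: reprfun_ext => u /=; rewrite mul1r. Qed.
Let rscaleDr : right_distributive rscale +%R.
Proof. by move=> a x y; apply: reprfun_ext => u; apply: mulrDr. Qed.
Let rscaleDl x : {morph rscale^~ x : a b / a + b}.
Proof. by move=> a b; apply: reprfun_ext => u; apply: mulrDl. Qed.
HB.instance Definition _ :=
  GRing.Zmodule_isLmodule.Build K R rscaleA rscale1 rscaleDr rscaleDl.

Let rone : R := ReprFun (representative_counit g).
Let rmul (f h : R) : R := ReprFun (representative_conv (reprfunP f) (reprfunP h)).

Let rmulA : associative rmul.
Proof.
move=> f h k; apply: reprfun_ext => u; rewrite /= /conv.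
pose T3 (x : tens (tens U U) U) : K^o :=
  \sw_(t, c <- x) ((\sw_(a, b <- t) (f a * h b : K^o)) * k c : K^o).
have bfh := mulK_bilinear (reprfun_lin f) (reprfun_lin h).
have T3l : linear T3.
  apply: swd_linear; apply: mulK_bilinear; last exact: reprfun_lin.
  exact: (swd_linear bfh).
have T3p a b c : T3 (a ⊗ b ⊗ c) = f a * h b * k c.
  rewrite /T3 swd_pure ?swd_pure //; apply: mulK_bilinear; last exact: reprfun_lin.
  exact: (swd_linear bfh).
have := congr1 T3 (comulA u); rewrite !(lin_swd _ _ T3l) => E.
transitivity (T3 (\sw_(a, b <- comul u) \sw_(c, d <- comul b) (a ⊗ c ⊗ d))).
  rewrite (lin_swd _ _ T3l); apply: (eq_swd (Z := K^o)) => a b; rewrite (lin_swd _ _ T3l).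
  by rewrite swd_mulKl; apply: (eq_swd (Z := K^o)) => c d; rewrite T3p mulrA.
rewrite (lin_swd _ _ T3l) -E; apply: (eq_swd (Z := K^o)) => a b; rewrite (lin_swd _ _ T3l).
by rewrite swd_mulKr; apply: (eq_swd (Z := K^o)) => c d; rewrite T3p.
Qed.

Let rmulC : commutative rmul.
Proof.
move=> f h; apply: reprfun_ext => u; rewrite /= /conv.
have bfh := mulK_bilinear (reprfun_lin f) (reprfun_lin h).
rewrite -[in LHS](comulC u) [LHS](lin_swd (f := fun t => swd t _) _ _ (swd_linear bfh)).
by apply: (eq_swd (Z := K^o)) => a b; rewrite swd_pure // mulrC.
Qed.

Let rmul1 : left_id rone rmul.
Proof.
move=> f; apply: reprfun_ext => u; rewrite /= /conv -[in RHS](counitl u).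
rewrite [RHS](lin_swd _ _ (reprfun_linear f)).
by apply: (eq_swd (Z := K^o)) => a b; rewrite (scalZ (reprfun_lin f)).
Qed.

Let rmulDl : left_distributive rmul +%R.
Proof.
move=> x y z; apply: reprfun_ext => u; rewrite /= /conv /swd /teval -big_split.
by apply: eq_bigr => p _; rewrite mulrDl.
Qed.

Let rone_neq0 : rone != 0.
Proof.
apply/eqP => /(congr1 (fun f : R => f 1)) /=; rewrite counit1.
by move/eqP; rewrite oner_eq0.
Qed.

HB.instance Definition _ :=
  GRing.Zmodule_isComNzRing.Build R rmulA rmulC rmul1 rmulDl rone_neq0.

Let rscaleAl (a : K) (u v : R) : a *: (u * v) = (a *: u) * v.
Proof.
apply: reprfun_ext => x; rewrite /= /conv swd_mulKl.
by apply: (eq_swd (Z := K^o)) => c d; rewrite mulrA.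
Qed.
HB.instance Definition _ := GRing.Lmodule_isLalgebra.Build K R rscaleAl.
HB.instance Definition _ := GRing.Lalgebra_isComAlgebra.Build K R.

Lemma reprfunE0 u : (0 : R) u = 0. Proof. by []. Qed.
Lemma reprfunE1 u : (1 : R) u = counit u. Proof. by []. Qed.
Lemma reprfunED (f h : R) u : (f + h) u = f u + h u. Proof. by []. Qed.
Lemma reprfunEZ c (f : R) u : (c *: f) u = c * f u. Proof. by []. Qed.
Lemma reprfunEM (f h : R) u : (f * h) u = \sw_(a, b <- comul u) (f a * h b : K^o).
Proof. by []. Qed.

Let ev_lin u : scalar (fun f : R => f u).
Proof. by move=> c f h; rewrite reprfunED reprfunEZ. Qed.
Let ev0 (f : R) : (forall u, f u = 0) -> f = 0.
Proof. by move=> h; apply: reprfun_ext => u; rewrite h. Qed.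
Let ev2_bilin u v : is_bilinear (fun a b : R => a u * b v : K^o).
Proof. exact: mulK_bilinear. Qed.

Let ev2 (t : tens R R) (u v : U) : K := \sw_(a, b <- t) (a u * b v : K^o).

Let ev2_inj (s t : tens R R) : (forall u v, ev2 s u v = ev2 t u v) -> s = t.
Proof. exact: (tens_sep (e := fun (f : R) u => f u) (e' := fun (f : R) u => f u)). Qed.

Let ev2_lin u v : scalar (fun t => ev2 t u v).
Proof. exact: (swd_linear (ev2_bilin u v)). Qed.

Let ev2_pure u v a b : ev2 (a ⊗ b) u v = a u * b v.
Proof. exact: (swd_pure _ _ (ev2_bilin u v)). Qed.

(* The coproduct of f is the tensor whose value at (u, v) is f (u * v). *)
Definition reprfun_comul (f : R) : tens R R :=
  xget 0 [set t : tens R R |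
    forall u v, \sw_(a, b <- t) (a u * b v : K^o) = f (u * v)]%classic.

Let comulE f u v : ev2 (reprfun_comul f) u v = f (u * v).
Proof.
rewrite /ev2 /reprfun_comul; case: xgetP => [t _ ->//|/(_ _)] ht; exfalso.
have [I [m [t [p [iI fI pl pI hp]]]]] := representative_coord (reprfunP f).
have hcod : fin_codim I.
  by exists m, t => w; exists (p^~ w); apply: hp.
have rp i : representative (p i) by split=> //; exists I; split=> //; exact: pI.
have rt i : representative (fun u => f (u * t i)).
  split; first by apply: mulr_scalar; exact: reprfun_lin.
  by exists I; split=> // x Ix; apply: fI; have [] := iI.2 (t i) _ Ix.
apply: (ht (\sum_(i < m) ReprFun (rt i) ⊗ ReprFun (rp i))) => x y.
rewrite (lin_sum (swd_linear (ev2_bilin x y))).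
rewrite -[y in RHS](subrK (\sum_(i < m) p i y *: t i)) mulrDr.
rewrite (scalD (reprfun_lin f)) fI ?add0r; last by have [] := iI.2 x _ (hp y).
rewrite mulr_sumr (scal_sum (reprfun_lin f)).
apply: eq_bigr => i _; rewrite swd_pure //=.
by rewrite -scalerAr (scalZ (reprfun_lin f)) mulrC.
Qed.

Lemma reprfun_comulE f u v :
  \sw_(a, b <- reprfun_comul f) (a u * b v : K^o) = f (u * v).
Proof. exact: comulE. Qed.

Definition reprfun_counit (f : R) : K := f 1.
Definition reprfun_antipode (f : R) : R := ReprFun (representative_antipode (reprfunP f)).

Let rD_lin : linear reprfun_comul.
Proof.
move=> c f h; apply: ev2_inj => u v.
by rewrite ev2_lin !comulE reprfunED reprfunEZ.
Qed.

Let reps_lin : scalar reprfun_counit.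
Proof. exact: ev_lin. Qed.

Let rS_lin : linear reprfun_antipode.
Proof. by move=> c f h; apply: reprfun_ext. Qed.

Let rD1 : reprfun_comul 1 = 1 ⊗ 1.
Proof.
by apply: ev2_inj => u v; rewrite comulE ev2_pure !reprfunE1 counitM.
Qed.

Let rDM f h : reprfun_comul (f * h) = reprfun_comul f * reprfun_comul h.
Proof.
apply: ev2_inj => u v; rewrite comulE reprfunEM.
rewrite [LHS](conv_mulE u v (reprfun_lin f) (reprfun_lin h)).
rewrite /ev2 swd_mul; last exact: ev2_bilin.
transitivity (\sw_(x, y <- comul u) \sw_(z, w <- comul v)
    \sw_(a, b <- reprfun_comul f) \sw_(c, d <- reprfun_comul h)
      ((a x * b z) * (c y * d w) : K^o)).
  apply: (eq_swd (Z := K^o)) => x y; apply: (eq_swd (Z := K^o)) => z w.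
  rewrite -!comulE /ev2 swd_mulKr; apply: (eq_swd (Z := K^o)) => a b.
  exact: (swd_mulKl (reprfun_comul h) (fun c d => c y * d w : K^o) (a x * b z)).
under eq_swd do rewrite swd_exchange.
rewrite swd_exchange.
under eq_swd do under eq_swd do rewrite swd_exchange.
under eq_swd do rewrite swd_exchange.
apply: (eq_swd (Z := K^o)) => a b; apply: (eq_swd (Z := K^o)) => c d.
rewrite !reprfunEM swd_mulKr; apply: (eq_swd (Z := K^o)) => x y.
apply: esym; apply: etrans (swd_mulKl (comul v) (fun z w => b z * d w : K^o) (a x * c y)) _.
by apply: (eq_swd (Z := K^o)) => z w; rewrite mulrACA.
Qed.

Let reps1 : reprfun_counit 1 = 1. Proof. exact: counit1. Qed.
Let repsM f h : reprfun_counit (f * h) = reprfun_counit f * reprfun_counit h.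
Proof.
rewrite /reprfun_counit reprfunEM comul1 swd_pure //.
by apply: mulK_bilinear; exact: reprfun_lin.
Qed.

Let ev3 (t : tens (tens R R) R) (p : U * U) (w : U) : K :=
  \sw_(a, b <- t) (ev2 a p.1 p.2 * b w : K^o).

Let ev3_bilin (p : U * U) w : is_bilinear (fun a (b : R) => ev2 a p.1 p.2 * b w : K^o).
Proof. by apply: mulK_bilinear; [exact: ev2_lin | exact: ev_lin]. Qed.

Let ev3_inj (s t : tens (tens R R) R) :
  (forall u v w, ev3 s (u, v) w = ev3 t (u, v) w) -> s = t.
Proof.
move=> h; apply: (tens_sep (e := fun t (p : U * U) => ev2 t p.1 p.2)
  (e' := fun (f : R) u => f u)) => //.
- move=> x hx; apply: ev2_inj => u v; rewrite (scal0 (ev2_lin u v)).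
  exact: (hx (u, v)).
- by move=> [u v] w; exact: h.
Qed.

Let ev3_lin p w : linear (fun t => ev3 t p w : K^o).
Proof. exact: (swd_linear (ev3_bilin p w)). Qed.

Let ev3_pure a b c u v w : ev3 (a ⊗ b ⊗ c) (u, v) w = a u * b v * c w.
Proof. by rewrite /ev3 swd_pure ?ev2_pure //; exact: ev3_bilin. Qed.

Let rDA f :
  \sw_(a, b <- reprfun_comul f) \sw_(c, d <- reprfun_comul a) (c ⊗ d ⊗ b) =
  \sw_(a, b <- reprfun_comul f) \sw_(c, d <- reprfun_comul b) (a ⊗ c ⊗ d).
Proof.
apply: ev3_inj => u v w.
rewrite !(lin_swd _ _ (ev3_lin (u, v) w)); transitivity (f (u * v * w)).
  rewrite -comulE; apply: (eq_swd (Z := K^o)) => a b.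
  rewrite (lin_swd _ _ (ev3_lin (u, v) w)) -[a (u * v)]comulE /ev2 swd_mulKr.
  by apply: (eq_swd (Z := K^o)) => c d; rewrite ev3_pure.
rewrite -mulrA -comulE; apply: (eq_swd (Z := K^o)) => a b.
rewrite (lin_swd _ _ (ev3_lin (u, v) w)) -[b (v * w)]comulE /ev2 swd_mulKl.
by apply: (eq_swd (Z := K^o)) => c d; rewrite ev3_pure mulrA.
Qed.

Let evl u : linear (fun f : R => f u : K^o).
Proof. exact: ev_lin. Qed.

Let rel f : \sw_(a, b <- reprfun_comul f) (reprfun_counit a *: b) = f.
Proof.
apply: reprfun_ext => u; rewrite (lin_swd _ _ (evl u)) -[u in RHS]mul1r -comulE.
exact: (eq_swd (Z := K^o)).
Qed.

Let rer f : \sw_(a, b <- reprfun_comul f) (reprfun_counit b *: a) = f.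
Proof.
apply: reprfun_ext => u; rewrite (lin_swd _ _ (evl u)) -[u in RHS]mulr1 -comulE.
by apply: (eq_swd (Z := K^o)) => a b; rewrite reprfunEZ mulrC.
Qed.

Let ral f : \sw_(a, b <- reprfun_comul f) (reprfun_antipode a * b) =
  (reprfun_counit f)%:A.
Proof.
apply: reprfun_ext => u; rewrite (lin_swd _ _ (evl u)).
under eq_swd do rewrite reprfunEM.
rewrite swd_exchange reprfunEZ reprfunE1.
transitivity (\sw_(a, b <- comul u) (f (antipode a * b) : K^o)).
  by apply: (eq_swd (Z := K^o)) => a b; rewrite -comulE.
rewrite -(lin_swd _ _ (reprfun_linear f)) antipodel (scalZ (reprfun_lin f)).
by rewrite mulrC.
Qed.

Let rar f : \sw_(a, b <- reprfun_comul f) (a * reprfun_antipode b) =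
  (reprfun_counit f)%:A.
Proof.
apply: reprfun_ext => u; rewrite (lin_swd _ _ (evl u)).
under eq_swd do rewrite reprfunEM.
rewrite swd_exchange reprfunEZ reprfunE1.
transitivity (\sw_(a, b <- comul u) (f (a * antipode b) : K^o)).
  by apply: (eq_swd (Z := K^o)) => a b; rewrite -comulE.
rewrite -(lin_swd _ _ (reprfun_linear f)) antipoder (scalZ (reprfun_lin f)).
by rewrite mulrC.
Qed.

HB.instance Definition _ := Algebra_isHopf.Build K R
  rD_lin reps_lin rS_lin rD1 rDM reps1 repsM rDA rel rer ral rar.

End RepresentativeHopf.


Record lieMatchedPair (K : fieldType) (g1 g2 : lieAlgType K) := LieMatchedPair {
  mlact : g2 -> g1 -> g1;
  mract : g2 -> g1 -> g2;
  mlact_bilinear : is_bilinear mlact;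
  mract_bilinear : is_bilinear mract;
  mlact_lie : forall z x X,
    mlact (lie z x) X = mlact z (mlact x X) - mlact x (mlact z X);
  mract_lie : forall z X Y,
    mract z (lie X Y) = mract (mract z X) Y - mract (mract z Y) X;
  mlact_compat : forall z X Y,
    mlact z (lie X Y) = lie (mlact z X) Y + lie X (mlact z Y)
                        + mlact (mract z X) Y - mlact (mract z Y) X;
  mract_compat : forall z x X,
    mract (lie z x) X = lie (mract z X) x + lie z (mract x X)
                        + mract z (mlact x X) - mract x (mlact z X)
}.

(* m only selects the bracket put on g1 * g2. *)
Definition dcross (K : fieldType) (g1 g2 : lieAlgType K) (m : lieMatchedPair g1 g2) : Type :=
  (g1 * g2)%type.

Section DoubleCrossedSum.
Variables (K : fieldType) (g1 g2 : lieAlgType K) (m : lieMatchedPair g1 g2).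
Implicit Types (X Y Z : g1) (z x e : g2).

Local Notation "z |> X" := (mlact m z X) (at level 40).
Local Notation "z <| X" := (mract m z X) (at level 40).

HB.instance Definition _ := Vector.copy (dcross m) (g1 * g2)%type.

Definition dcross_lie (p q : dcross m) : dcross m :=
  (lie p.1 q.1 + p.2 |> q.1 - q.2 |> p.1, lie p.2 q.2 + p.2 <| q.1 - q.2 <| p.1).

Let lieDl (g : lieAlgType K) (a b c : g) : lie (a + b) c = lie a c + lie b c.
Proof. exact: (linD (f := (@lie K g)^~ c) (lie_bilinear.1 c)). Qed.
Let lieDr (g : lieAlgType K) (a b c : g) : lie a (b + c) = lie a b + lie a c.
Proof. exact: (linD (lie_bilinear.2 a)). Qed.
Let lieNl (g : lieAlgType K) (a c : g) : lie (- a) c = - lie a c.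
Proof. exact: (linN (f := (@lie K g)^~ c) (lie_bilinear.1 c)). Qed.
Let lieNr (g : lieAlgType K) (a c : g) : lie a (- c) = - lie a c.
Proof. exact: (linN (lie_bilinear.2 a)). Qed.
Let laDl z x X : (z + x) |> X = z |> X + x |> X.
Proof. exact: (linD (f := (@mlact K g1 g2 m)^~ X) ((mlact_bilinear m).1 X)). Qed.
Let laDr z X Y : z |> (X + Y) = z |> X + z |> Y.
Proof. exact: (linD ((mlact_bilinear m).2 z)). Qed.
Let laNl z X : (- z) |> X = - (z |> X).
Proof. exact: (linN (f := (@mlact K g1 g2 m)^~ X) ((mlact_bilinear m).1 X)). Qed.
Let laNr z X : z |> (- X) = - (z |> X).
Proof. exact: (linN ((mlact_bilinear m).2 z)). Qed.
Let raDl z x X : (z + x) <| X = z <| X + x <| X.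
Proof. exact: (linD (f := (@mract K g1 g2 m)^~ X) ((mract_bilinear m).1 X)). Qed.
Let raDr z X Y : z <| (X + Y) = z <| X + z <| Y.
Proof. exact: (linD ((mract_bilinear m).2 z)). Qed.
Let raNl z X : (- z) <| X = - (z <| X).
Proof. exact: (linN (f := (@mract K g1 g2 m)^~ X) ((mract_bilinear m).1 X)). Qed.
Let raNr z X : z <| (- X) = - (z <| X).
Proof. exact: (linN ((mract_bilinear m).2 z)). Qed.
Let expand := (lieDl, lieDr, lieNl, lieNr, laDl, laDr, laNl, laNr, raDl, raDr, raNl, raNr).

Let coordP (V : vectType K) (v w : V) :
  (forall i, coord (vbasis fullv) i v = coord (vbasis fullv) i w) -> v = w.
Proof.
move=> h; rewrite (coord_vbasis (memvf v)) (coord_vbasis (memvf w)).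
by apply: eq_bigr => i _; rewrite h.
Qed.

Let dcross_bilinear : is_bilinear dcross_lie.
Proof.
have [[l1 r1] [l2 r2]] := (@lie_bilinear K g1, @lie_bilinear K g2).
have [[la ra] [lb rb]] := (mlact_bilinear m, mract_bilinear m).
split=> [[Z e]|[Z e]] c [X z] [Y x]; congr (_, _) => /=;
  rewrite ?l1 ?l2 ?r1 ?r2 ?la ?ra ?lb ?rb;
  by apply: coordP => i; rewrite !(linearD, linearN, linearZ) /=; ring.
Qed.

Let dcross_xx p : dcross_lie p p = 0.
Proof. by congr (_, _); rewrite /= liexx add0r subrr. Qed.

Let dcross_jacobi p q r : dcross_lie p (dcross_lie q r) +
  dcross_lie q (dcross_lie r p) + dcross_lie r (dcross_lie p q) = 0.
Proof.
case: p q r => [X z] [Y x] [Z e]; congr (_, _) => /=.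
  have := lie_jacobi X Y Z.
  rewrite !expand !mlact_compat !mlact_lie.
  rewrite (lieC Z (z |> Y)) (lieC X (x |> Z)) (lieC Y (e |> X)).
  move=> J; apply: coordP => i; move/(congr1 (fun v => coord (vbasis fullv) i v)): J.
  rewrite !(linearD, linearN, linear0).
  move=> J; rewrite -[RHS]J; ring.
have := lie_jacobi z x e.
rewrite !expand !mract_compat !mract_lie.
rewrite (lieC e (x <| X)) (lieC z (e <| Y)) (lieC x (z <| Z)).
move=> J; apply: coordP => i; move/(congr1 (fun v => coord (vbasis fullv) i v)): J.
rewrite !(linearD, linearN, linear0).
move=> J; rewrite -[RHS]J; ring.
Qed.

HB.instance Definition _ :=
  Vector_isLieAlgebra.Build K (dcross m) dcross_bilinear dcross_xx dcross_jacobi.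

End DoubleCrossedSum.


Section EnvelopingActions.
Variables (K : fieldType) (g1 g2 : lieAlgType K) (m : lieMatchedPair g1 g2).

Lemma dcross_in1_lie_map : lie_map (fun X => Uin ((X, 0) : dcross m)).
Proof.
have [lU cU] := Uin_lie_map (dcross m).
split=> [c X Y|X Y].
  rewrite -lU; congr Uin.
  transitivity ((c *: X + Y, c *: 0 + 0) : dcross m) => //.
  by rewrite scaler0 addr0.
rewrite -cU; congr Uin; congr (_, _) => /=.
  by rewrite !(lin0 (f := (@mlact _ _ _ m)^~ _) ((mlact_bilinear m).1 _)) addr0 subr0.
by rewrite liexx !(lin0 (f := (@mract _ _ _ m)^~ _) ((mract_bilinear m).1 _)) addr0 subr0.
Qed.

Lemma dcross_in2_lie_map : lie_map (fun z => Uin ((0, z) : dcross m)).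
Proof.
have [lU cU] := Uin_lie_map (dcross m).
split=> [c X Y|X Y].
  rewrite -lU; congr Uin.
  transitivity ((c *: 0 + 0, c *: X + Y) : dcross m) => //.
  by rewrite scaler0 addr0.
rewrite -cU; congr Uin; congr (_, _) => /=.
  by rewrite liexx !(lin0 ((mlact_bilinear m).2 _)) addr0 subr0.
by rewrite !(lin0 ((mract_bilinear m).2 _)) addr0 subr0.
Qed.

(* The algebra morphisms U(g1), U(g2) -> U(g1 ⋈ g2) induced by the inclusions. *)
Definition Uin1 : Uenv g1 -> Uenv (dcross m) := Ulift (fun X => Uin ((X, 0) : dcross m)).
Definition Uin2 : Uenv g2 -> Uenv (dcross m) := Ulift (fun z => Uin ((0, z) : dcross m)).

Definition Umult (t : tens (Uenv g1) (Uenv g2)) : Uenv (dcross m) :=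
  \sw_(a, b <- t) (Uin1 a * Uin2 b).

(* Umult is bijective, so xget selects the preimage of v u; its default value 0
   is never used. *)
Definition Upsi (v : Uenv g2) (u : Uenv g1) : tens (Uenv g1) (Uenv g2) :=
  xget 0 [set t | Umult t = Uin2 v * Uin1 u]%classic.

Definition Ulact (v : Uenv g2) (u : Uenv g1) : Uenv g1 :=
  \sw_(a, b <- Upsi v u) (counit b *: a).

Definition Uract (v : Uenv g2) (u : Uenv g1) : Uenv g2 :=
  \sw_(a, b <- Upsi v u) (counit a *: b).

End EnvelopingActions.

Section HopfMatchedPair.
Variables (K : fieldType) (H F : hopfAlgType K).
Variables (act : H -> F -> F) (coact : H -> tens H F).

Record is_module_algebra : Prop := {
  act_bilinear : is_bilinear act;
  act1l : forall f, act 1 f = f;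
  actMl : forall u v f, act (u * v) f = act u (act v f);
  act1r : forall u, act u 1 = (counit u)%:A;
  actMr : forall u f h,
    act u (f * h) = \sw_(u1, u2 <- comul u) (act u1 f * act u2 h)
}.

Record is_comodule_coalgebra : Prop := {
  coact_linear : linear coact;
  coactA : forall u,
    \sw_(a, f <- coact u) \sw_(b, h <- coact a) (b ⊗ h ⊗ f) =
    \sw_(a, f <- coact u) \sw_(f1, f2 <- comul f) (a ⊗ f1 ⊗ f2);
  coact_counit : forall u, \sw_(a, f <- coact u) (counit f *: a) = u;
  coact_comul : forall u,
    \sw_(a, f <- coact u) \sw_(a1, a2 <- comul a) (a1 ⊗ a2 ⊗ f) =
    \sw_(u1, u2 <- comul u) \sw_(a, f <- coact u1) \sw_(b, h <- coact u2)
      (a ⊗ b ⊗ (f * h));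
  counit_coact : forall u, \sw_(a, f <- coact u) (counit a *: f) = (counit u)%:A
}.

Definition coact_product_rule : Prop := forall u v,
  coact (u * v) =
  \sw_(u1, u2 <- comul u) \sw_(a, f <- coact u1) \sw_(b, h <- coact v)
    ((a * b) ⊗ (f * act u2 h)).

Record is_hopf_matched_pair : Prop := {
  hmp_module_algebra : is_module_algebra;
  hmp_comodule_coalgebra : is_comodule_coalgebra;
  hmp_counit : forall u f, counit (act u f) = counit u * counit f;
  hmp_comul : forall u f,
    comul (act u f) =
    \sw_(u1, u2 <- comul u) \sw_(f1, f2 <- comul f) \sw_(a, h <- coact u1)
      (act a f1 ⊗ (h * act u2 f2));
  hmp_coact1 : coact 1 = 1 ⊗ 1;
  hmp_coactM : coact_product_rule;
  hmp_compat : forall u f,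
    \sw_(u1, u2 <- comul u) \sw_(a, h <- coact u2) (a ⊗ (act u1 f * h)) =
    \sw_(u1, u2 <- comul u) \sw_(a, h <- coact u1) (a ⊗ (h * act u2 f))
}.

End HopfMatchedPair.

Section CanonicalMatchedPair.
Variables (K : fieldType) (g1 g2 : lieAlgType K) (m : lieMatchedPair g1 g2).

Definition is_canonical_action (act : Uenv g1 -> reprfun g2 -> reprfun g2) : Prop :=
  forall u f v, act u f v = f (Uract m v u).

(* f i j is the function written f with lower index i and upper index j. *)
Definition is_coaction_matrix n (X : n.-tuple g1) (f : 'I_n -> 'I_n -> reprfun g2) : Prop :=
  forall (v : Uenv g2) i, Ulact m v (Uin (tnth X i)) = \sum_(j < n) f i j v *: Uin (tnth X j).

Definition is_coaction_extension n (X : n.-tuple g1) (f : 'I_n -> 'I_n -> reprfun g2)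
    (act : Uenv g1 -> reprfun g2 -> reprfun g2)
    (coact : Uenv g1 -> tens (Uenv g1) (reprfun g2)) : Prop :=
  [/\ linear coact, coact 1 = 1 ⊗ 1,
      forall i, coact (Uin (tnth X i)) = \sum_(j < n) Uin (tnth X j) ⊗ f i j
    & coact_product_rule act coact].

End CanonicalMatchedPair.

(* Main.v *)
Require Import Defs.
From HB Require Import structures.
From mathcomp Require Import all_boot all_order all_algebra.
From mathcomp Require Import boolp classical_sets functions reals complex.

Set Implicit Arguments.
Unset Strict Implicit.
Unset Printing Implicit Defensive.

Import GRing.Theory.

Local Open Scope ring_scope.

(* Let g1 ⋈ g2 act on U(g1) ⊗ U(g2) as it would by left multiplication on U(g1 ⋈ g2).
   The orbit map of 1 ⊗ 1 is then inverse to multiplication, so that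
   U(g1) ⊗ U(g2) = U(g1 ⋈ g2) without appealing to the PBW theorem. The two coalgebra
   projections of U(g1 ⋈ g2) onto its factors commute with one-sided multiplication by
   a factor, and together they reconstruct every element from its coproduct; the
   identities relating v ▷ u and v ◁ u follow.
   Evaluating the second factor of U(g1) ⊗ R(g2) at all v in U(g2) is injective, the
   coaction is characterised by u_<0> u_<1>(v) = v ▷ u, and each axiom of a matched pair
   of Hopf algebras becomes one of those identities. Representativity of v |-> f(v ◁ u)
   and existence of the coaction both reduce by induction to u in g1, where v ▷ u stays
   in the finite dimensional space g1. *)

(** * Modules over enveloping algebras *)

Section LieModule.
Variables (K : fieldType) (V : lmodType K).

(* The scalar component only makes this algebra nontrivial when V = 0. *)
Record lend := Lend { lend_scal : K; lend_fun :> V -> V; lend_lin : linear lend_fun }.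

HB.instance Definition _ := gen_eqMixin lend.
HB.instance Definition _ := gen_choiceMixin lend.

Lemma lend_ext (f h : lend) : lend_scal f = lend_scal h -> f =1 h -> f = h.
Proof.
case: f h => [c f fl] [d h hl] /= -> /funext fh; subst h.
by congr Lend; apply: Prop_irrelevance.
Qed.

Let zero_lin : linear (fun _ : V => 0 : V).
Proof. by move=> c x y; rewrite scaler0 addr0. Qed.
Let add_lin (f h : lend) : linear (fun v => f v + h v).
Proof. by move=> c x y; rewrite !lend_lin scalerDr addrACA. Qed.
Let scale_lin c (f : lend) : linear (fun v => c *: f v).
Proof. by apply: scaler_lin; exact: lend_lin. Qed.
Let mul_lin (f h : lend) : linear (fun v => f (h v)).
Proof. by apply: comp_linear; exact: lend_lin. Qed.

Let zero := Lend 0 zero_lin.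
Let one := Lend 1 (@id_lin K V).
Let add f h := Lend (lend_scal f + lend_scal h) (add_lin f h).
Let scale c f := Lend (c * lend_scal f) (scale_lin c f).
Let mul f h := Lend (lend_scal f * lend_scal h) (mul_lin f h).

Let addA : associative add.
Proof. by move=> f h k; apply: lend_ext => [|v]; apply: addrA. Qed.
Let addC : commutative add.
Proof. by move=> f h; apply: lend_ext => [|v]; apply: addrC. Qed.
Let add0 : left_id zero add.
Proof. by move=> f; apply: lend_ext => [|v]; apply: add0r. Qed.
Let addN : left_inverse zero (scale (-1)) add.
Proof.
by move=> f; apply: lend_ext => [|v] /=; rewrite ?mulN1r ?scaleN1r addNr.
Qed.
HB.instance Definition _ := GRing.isZmodule.Build lend addA addC add0 addN.

Let scaleA a b f : scale a (scale b f) = scale (a * b) f.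
Proof. by apply: lend_ext => [|v] /=; rewrite ?mulrA ?scalerA. Qed.
Let scale1 : left_id 1 scale.
Proof. by move=> f; apply: lend_ext => [|v] /=; rewrite ?mul1r ?scale1r. Qed.
Let scaleDr : right_distributive scale +%R.
Proof. by move=> c f h; apply: lend_ext => [|v] /=; rewrite ?mulrDr ?scalerDr. Qed.
Let scaleDl f : {morph scale^~ f : a b / a + b}.
Proof. by move=> a b; apply: lend_ext => [|v] /=; rewrite ?mulrDl ?scalerDl. Qed.
HB.instance Definition _ :=
  GRing.Zmodule_isLmodule.Build K lend scaleA scale1 scaleDr scaleDl.

Let mulA : associative mul.
Proof. by move=> f h k; apply: lend_ext => [|v] //=; apply: mulrA. Qed.
Let mul1 : left_id one mul.
Proof. by move=> f; apply: lend_ext => [|v] //=; apply: mul1r. Qed.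
Let mulr1 : right_id one mul.
Proof. by move=> f; apply: lend_ext => [|v] //=; apply: mulr1. Qed.
Let mulDl : left_distributive mul +%R.
Proof. by move=> f h k; apply: lend_ext => [|v] //=; apply: mulrDl. Qed.
Let mulDr : right_distributive mul +%R.
Proof.
move=> f h k; apply: lend_ext => [|v] /=; first exact: mulrDr.
exact: linD (lend_lin f) _ _.
Qed.
Let one_neq0 : one != zero.
Proof. by apply/eqP => /(congr1 lend_scal)/eqP; rewrite oner_eq0. Qed.
HB.instance Definition _ :=
  GRing.Zmodule_isNzRing.Build lend mulA mul1 mulr1 mulDl mulDr one_neq0.

Let lscaleAl (a : K) (f h : lend) : a *: (f * h) = (a *: f) * h.
Proof. by apply: lend_ext => [|v] //=; apply: mulrA. Qed.
HB.instance Definition _ := GRing.Lmodule_isLalgebra.Build K lend lscaleAl.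
Let lscaleAr (a : K) (f h : lend) : a *: (f * h) = f * (a *: h).
Proof.
apply: lend_ext => [|v] /=; first exact: mulrCA.
by rewrite (linZ (lend_lin f)).
Qed.
HB.instance Definition _ := GRing.Lalgebra_isAlgebra.Build K lend lscaleAr.

Variables (g : lieAlgType K).

Record lie_module (rho : g -> V -> V) : Prop := {
  lie_module_bilinear : is_bilinear rho;
  lie_moduleP : forall x y v, rho (lie x y) v = rho x (rho y v) - rho y (rho x v)
}.

Variable rho : g -> V -> V.

(** The scalar component 0 is the trivial character of [g], compatible with brackets because
    commutators in [K] vanish. *)
Definition lie_lend (rhoP : lie_module rho) x : lend :=
  Lend 0 ((lie_module_bilinear rhoP).2 x).

Lemma lie_lend_lie_map (rhoP : lie_module rho) : lie_map (lie_lend rhoP).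
Proof.
split=> [c x y|x y]; apply: lend_ext => [|v] /=.
- by rewrite mulr0 addr0.
- exact: (lie_module_bilinear rhoP).1.
- by rewrite mul0r mulr0 addr0.
- by rewrite (lie_moduleP rhoP) scaleN1r.
Qed.

Definition Uact (rhoP : lie_module rho) (u : Uenv g) (v : V) : V :=
  Ulift (lie_lend rhoP) u v.

Lemma Uact_bilinear rhoP : is_bilinear (Uact rhoP).
Proof.
have rl := Ulift_lin (lie_lend_lie_map rhoP).
by split=> [v c u w|u]; [rewrite /Uact rl | exact: lend_lin].
Qed.

Lemma Uact1 rhoP v : Uact rhoP 1 v = v.
Proof. by rewrite /Uact (Ulift1 (lie_lend_lie_map rhoP)). Qed.

Lemma UactM rhoP u w v : Uact rhoP (u * w) v = Uact rhoP u (Uact rhoP w v).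
Proof. by rewrite /Uact (UliftM (lie_lend_lie_map rhoP)). Qed.

Lemma UactX rhoP x v : Uact rhoP (Uin x) v = rho x v.
Proof. by rewrite /Uact (UliftIn _ (lie_lend_lie_map rhoP)). Qed.

End LieModule.

(** * The action of the double crossed sum *)

Section BilinearFacts.
Variables (K : fieldType) (U V W : lmodType K) (b : U -> V -> W).
Hypothesis bb : is_bilinear b.
Lemma bilDl x y v : b (x + y) v = b x v + b y v.
Proof. exact: (linD (f := b^~ v) (bb.1 v)). Qed.
Lemma bilDr u x y : b u (x + y) = b u x + b u y.
Proof. exact: (linD (bb.2 u)). Qed.
Lemma bilNl x v : b (- x) v = - b x v.
Proof. exact: (linN (f := b^~ v) (bb.1 v)). Qed.
Lemma bilNr u x : b u (- x) = - b u x.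
Proof. exact: (linN (bb.2 u)). Qed.
Lemma bil0l v : b 0 v = 0.
Proof. exact: (lin0 (f := b^~ v) (bb.1 v)). Qed.
Lemma bil0r u : b u 0 = 0.
Proof. exact: (lin0 (bb.2 u)). Qed.
Lemma bilZl c x v : b (c *: x) v = c *: b x v.
Proof. exact: (linZ (f := b^~ v) (bb.1 v)). Qed.
Lemma bilZr c u x : b u (c *: x) = c *: b u x.
Proof. exact: (linZ (bb.2 u)). Qed.
End BilinearFacts.

Section TensMulLinear.
Variables (K : fieldType) (A B : algType K).
Lemma tensmulr_lin (t : tens A B) : linear (fun s : tens A B => t * s).
Proof. by move=> c x y; rewrite mulrDr tens_scalerAr. Qed.
Lemma tensmull_lin (t : tens A B) : linear (fun s : tens A B => s * t).
Proof. by move=> c x y; rewrite mulrDl tens_scalerAl. Qed.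
End TensMulLinear.

Section DoubleCrossModule.
Variables (K : fieldType) (g1 g2 : lieAlgType K) (m : lieMatchedPair g1 g2).
Local Notation A := (Uenv g1).
Local Notation B := (Uenv g2).
Local Notation M := (tens A B).
Local Notation "z |> X" := (mlact m z X) (at level 40).
Local Notation "z <| X" := (mract m z X) (at level 40).
Local Notation d := (\dim {: g2}).
Local Notation e := (vbasis {: g2}).
Local Notation E := (A * ('I_d * B -> M))%type.

Let lmul (X : g1) (t : M) : M := (Uin X ⊗ 1) * t.

(** A map linear in [z] is stored by its values on the basis [e], so that [E] is a plain function
    space; [ext] is the linear extension to all of [g2]. *)
Let ext (phi : 'I_d * B -> M) (z : g2) (b : B) : M :=
  \sum_(i < d) coord e i z *: phi (i, b).

Let ext_linl phi b : linear (fun z => ext phi z b).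
Proof.
by apply: sum_linear => i; apply: scalel_lin => c x y; rewrite linearP.
Qed.

Let ext_linr z b : linear (fun phi => ext phi z b).
Proof. by apply: sum_linear => i; apply: scaler_lin. Qed.

Let ext_uniq (F : g2 -> B -> M) z b : (linear (fun z => F z b)) ->
  ext (fun q => F e`_q.1 q.2) z b = F z b.
Proof.
move=> lF; rewrite [in RHS](coord_vbasis (memvf z)) (lin_sum lF).
by apply: eq_bigr => i _; rewrite (linZ lF).
Qed.

(* The second component of the image of (u, phi) is the function
   (z, b) |-> z X u b when phi is (z, b) |-> z u b. *)
Let cross (X : g1) (p : E) : E :=
  (Uin X * p.1, fun q : 'I_d * B => (Uin (e`_q.1 |> X) * p.1) ⊗ q.2 + lmul X (p.2 q)
                         + ext p.2 (e`_q.1 <| X) q.2).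

Let lmul_bilin : is_bilinear lmul.
Proof.
split=> [t c X Y|X]; last exact: tensmulr_lin.
by rewrite /lmul (Uin_lie_map g1).1 tpureDl tpureZl mulrDl -tens_scalerAl.
Qed.

Let lmulE X a b : lmul X (a ⊗ b) = (Uin X * a) ⊗ b.
Proof. by rewrite /lmul tensM mul1r. Qed.

Let lmul_lie X Y t : lmul (lie X Y) t = lmul X (lmul Y t) - lmul Y (lmul X t).
Proof.
by rewrite /lmul !mulrA !tensM !mul1r (Uin_lie_map g1).2 tpureBl mulrBl.
Qed.

Let ext_basis phi (i : 'I_d) b : ext phi e`_i b = phi (i, b).
Proof.
rewrite /ext (bigD1 i) //= coord_free ?(basis_free (vbasisP _)) // eqxx scale1r.
rewrite big1 ?addr0 // => j ij.
by rewrite coord_free ?(basis_free (vbasisP _)) // eq_sym (negPf ij) scale0r.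
Qed.

(** The formula defining [cross] on basis vectors is linear in [z], hence holds for every [z]. *)
Let ext_cross X p z b : ext (cross X p).2 z b =
  (Uin (z |> X) * p.1) ⊗ b + lmul X (ext p.2 z b) + ext p.2 (z <| X) b.
Proof.
pose F z b := (Uin (z |> X) * p.1) ⊗ b + lmul X (ext p.2 z b) + ext p.2 (z <| X) b.
rewrite -[RHS]/(F z b) -[RHS]ext_uniq; last first.
  have [lA _] := mlact_bilinear m; have [lB _] := mract_bilinear m.
  move=> c x y; rewrite /F lA lB (Uin_lie_map g1).1 mulrDl -scalerAl tpureDl tpureZl.
  rewrite !(ext_linl p.2) (lmul_bilin.2 X) !scalerDr.
  by rewrite (AC ((2*2)*2) ((1*3*5)*(2*4*6))).
congr (ext _ z b); apply/funext => -[i b'] /=.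
by rewrite /F ext_basis.
Qed.

Let cross_sub (V : zmodType) (p1 p2 q s t v w p1' p2' q' t' w' : V) :
  p1 + (p2 + q + s) + (t + v + w) - (p1' + (p2' + q' + v) + (t' + s + w')) =
  (p1 - p2' + (p2 - p1') + t - t') + (q - q') + (w - w').
Proof.
rewrite !opprD.
rewrite (AC (1*3*3*(1*3*3)) ((1*9)*(2*8)*5*12*(3*10)*(7*14)*(4*13)*(6*11))).
by rewrite /= !addrN !addr0.
Qed.

(** On second components the mixed terms of the two compositions cancel; what remains is the
    compatibility of ▷ with the bracket of [g1] together with the right action law of ◁. *)
Let cross_lie_module : lie_module cross.
Proof.
have [_ rA] := mlact_bilinear m; have [_ rB] := mract_bilinear m.
split; first split.
- move=> [u phi] c X Y; congr (_, _) => /=.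
    by rewrite (Uin_lie_map g1).1 mulrDl -scalerAl.
  apply/funext => -[i b].
  transitivity (c *: (cross X (u, phi)).2 (i, b) + (cross Y (u, phi)).2 (i, b)) => //=.
  rewrite rA rB (Uin_lie_map g1).1 mulrDl -scalerAl tpureDl tpureZl.
  rewrite (lmul_bilin.1 (phi (i, b))) (ext_linl phi) !scalerDr.
  by rewrite (AC (2*2*2) ((1*3*5)*(2*4*6))).
- move=> X c [u phi] [v psi]; congr (_, _) => /=.
    by rewrite mulrDr -scalerAr.
  apply/funext => -[i b].
  transitivity (c *: (cross X (u, phi)).2 (i, b) + (cross X (v, psi)).2 (i, b)) => //=.
  rewrite mulrDr -scalerAr tpureDl tpureZl.
  rewrite (lmul_bilin.2 X) (ext_linr (e`_i <| X) b) !scalerDr.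
  by rewrite (AC (2*2*2) ((1*3*5)*(2*4*6))).
- move=> X Y p; congr (_, _) => /=.
    by rewrite (Uin_lie_map g1).2 mulrBl !mulrA.
  apply/funext => -[i b].
  transitivity ((cross X (cross Y p)).2 (i, b) - (cross Y (cross X p)).2 (i, b)) => //=.
  rewrite !ext_cross /= !(bilDr lmul_bilin) !lmulE cross_sub.
  rewrite mlact_compat mract_lie (linB (Uin_lie_map g1).1) !(linD (Uin_lie_map g1).1).
  rewrite !(Uin_lie_map g1).2 lmul_lie (linB (ext_linl p.2 b)).
  by rewrite !(mulrBl, mulrDl) !(tpureBl, tpureDl) !mulrA.
Qed.

(** The pair attached to a = 1, where z 1 b is 1 ⊗ z b. Acting on it by [a] gives the pair of [a]
    and (z, b) |-> z a b, so [Phi a z b] is z a b rewritten with U(g1) on the left. The first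
    component keeps [a] available to the recursion for the second. *)
Let seed : E := (1, fun q : 'I_d * B => 1 ⊗ (Uin e`_q.1 * q.2)).
Let orb (a : A) : E := Uact cross_lie_module a seed.
Let Phi (a : A) (z : g2) (b : B) : M := ext (orb a).2 z b.

Let orb_lin : linear orb.
Proof. exact: (Uact_bilinear cross_lie_module).1. Qed.

Let orbM X a : orb (Uin X * a) = cross X (orb a).
Proof. by rewrite /orb UactM UactX. Qed.

Let orb1 a : (orb a).1 = a.
Proof.
elim/Uenv_ind: a => [|c u v IHu IHv||X u IHu].
- by rewrite (lin0 orb_lin).
- by rewrite orb_lin /= IHu IHv.
- by rewrite /orb Uact1.
- by rewrite orbM /= IHu.
Qed.

Let Phi_linl z b : linear (fun a => Phi a z b).
Proof. by move=> c u v; rewrite /Phi orb_lin (ext_linr z b). Qed.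

Let Phi_linz a b : linear (fun z => Phi a z b).
Proof. exact: ext_linl. Qed.

Let PhiM X a z b :
  Phi (Uin X * a) z b = (Uin (z |> X) * a) ⊗ b + lmul X (Phi a z b) + Phi a (z <| X) b.
Proof. by rewrite /Phi orbM ext_cross orb1. Qed.

Let Phi1 z b : Phi 1 z b = 1 ⊗ (Uin z * b).
Proof.
rewrite /Phi /orb Uact1 (ext_uniq (F := fun z b => 1 ⊗ (Uin z * b))) //.
by move=> c x y; rewrite (Uin_lie_map g2).1 mulrDl -scalerAl tpureDr tpureZr.
Qed.

(** [E] imposes no linearity in [b]; it is recovered by induction on [a], for all [z] at once since
    the recursion passes from [z] to [z <| X]. *)
Let Phi_linr a z : linear (Phi a z).
Proof.
elim/Uenv_ind: a z => [|c u v IHu IHv||X u IHu] z k x y.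
- by rewrite !(lin0 (Phi_linl z _)) scaler0 addr0.
- rewrite !(Phi_linl z) IHu IHv !scalerDr !scalerA [k * c]mulrC.
  by rewrite (AC (2*2) ((1*3)*(2*4))).
- by rewrite !Phi1 mulrDr -scalerAr tpureDr tpureZr.
- rewrite !PhiM IHu IHu tpureDr tpureZr (lmul_bilin.2 X) !scalerDr.
  by rewrite (AC (2*2*2) ((1*3*5)*(2*4*6))).
Qed.

(** Like [lmul], this is a left multiplication, now by an element of [g2]. *)
Let rmul (z : g2) (t : M) : M := \sw_(a, b <- t) Phi a z b.

Let rmul_bilin : is_bilinear rmul.
Proof.
split=> [t|z]; first by rewrite /rmul; apply: swd_linearF.
by apply: swd_linear; split=> ?; [apply: Phi_linl | apply: Phi_linr].
Qed.

Let rmulE z a b : rmul z (a ⊗ b) = Phi a z b.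
Proof. by rewrite /rmul swd_pure. Qed.

(** The relation z X = z ▷ X + X z + z ◁ X, which was built into [cross]. *)
Let rmul_lmul z X t : rmul z (lmul X t) =
  lmul (z |> X) t + lmul X (rmul z t) + rmul (z <| X) t.
Proof.
elim/tens_ind: t => [|a b t IH].
  by rewrite !(bil0r lmul_bilin, bil0r rmul_bilin) !addr0.
rewrite !(bilDr lmul_bilin, bilDr rmul_bilin) IH lmulE !rmulE PhiM lmulE.
by rewrite (AC (3*3) ((1*4)*(2*5)*(3*6))).
Qed.

Let jacobi_sub (V : zmodType) (l c' r c a1 p q l' r' a2 p' q' : V) :
  (l + c' + r) + (c + a1 + p) + q - ((l' + c + r') + (c' + a2 + p') + q') =
  (l - l') + (a1 - a2) + (p - q' + (q - p') + r - r').
Proof.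
rewrite !opprD.
rewrite (AC (3*3*1*(3*3*1)) ((1*8)*(5*12)*((6*14)*(7*13)*3*10)*(4*9)*(2*11))).
by rewrite /= !addrN !addr0.
Qed.

(* The defect D z x of the bracket relation satisfies
   [D z x, X] = D (z <| X) x + D z (x <| X), so it vanishes on all of U(g1) ⊗ U(g2)
   because it vanishes on 1 ⊗ U(g2). *)
Let rmul_lie z x t : rmul (lie z x) t = rmul z (rmul x t) - rmul x (rmul z t).
Proof.
elim/tens_ind: t => [|a b t IH]; first by rewrite !(bil0r rmul_bilin) subrr.
rewrite !(bilDr rmul_bilin) IH opprD addrACA; congr (_ + _) => {t IH}.
elim/Uenv_ind: a z x b => [|c u v IHu IHv||X u IHu] z x b.
- by rewrite (bil0l (@tpure_bilinear K A B)) !(bil0r rmul_bilin) subrr.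
- rewrite tpureDl tpureZl !(bilDr rmul_bilin, bilZr rmul_bilin) IHu IHv.
  by rewrite scalerBr opprD addrACA.
- by rewrite !rmulE !Phi1 !rmulE !Phi1 (Uin_lie_map g2).2 mulrBl tpureBr !mulrA.
- rewrite -lmulE !(rmul_lmul, bilDr rmul_bilin) jacobi_sub.
  rewrite mlact_lie mract_compat !(bilDl rmul_bilin, bilNl rmul_bilin).
  by rewrite (bilDl lmul_bilin) (bilNl lmul_bilin) !IHu (bilDr lmul_bilin) (bilNr lmul_bilin).
Qed.

Let dmul (p : dcross m) (t : M) : M := lmul p.1 t + rmul p.2 t.

Let dmul_sub (V : zmodType) (a1 b l b' r d1 a2 l' r' d2 : V) :
  a1 + b + (l + b' + r + d1) - (a2 + b' + (l' + b + r' + d2)) =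
  (a1 - a2 + l - l') + (d1 - d2 + r - r').
Proof.
rewrite !opprD.
rewrite (AC (2*(3*1)*(2*(3*1))) (((1*7)*3*9)*((6*12)*5*11)*(2*10)*(4*8))).
by rewrite /= !addrN !addr0.
Qed.

(** Brackets within [g1] and within [g2] are [lmul_lie] and [rmul_lie]; the mixed bracket is
    [rmul_lmul]. *)
Let dmul_lie_module : lie_module dmul.
Proof.
split; first split.
- move=> t c p q; rewrite /dmul (lmul_bilin.1 t) (rmul_bilin.1 t).
  by rewrite /= scalerDr addrACA.
- move=> p c s t; rewrite /dmul (lmul_bilin.2 p.1) (rmul_bilin.2 p.2).
  by rewrite /= scalerDr addrACA.
- move=> p q t; rewrite /dmul !(bilDr lmul_bilin, bilDr rmul_bilin) !rmul_lmul dmul_sub.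
  rewrite !(bilDl lmul_bilin, bilDl rmul_bilin, bilNl lmul_bilin, bilNl rmul_bilin).
  by rewrite lmul_lie rmul_lie.
Qed.

(** * Bijectivity of the multiplication U(g1) ⊗ U(g2) -> U(g1 ⋈ g2) *)

Lemma Uin1_spec : [/\ linear (@Uin1 _ _ _ m), Uin1 m 1 = 1,
  {morph @Uin1 _ _ _ m : u v / u * v} & forall X, Uin1 m (Uin X) = Uin ((X, 0) : dcross m)].
Proof. exact: Ulift_spec (dcross_in1_lie_map m). Qed.

Lemma Uin2_spec : [/\ linear (@Uin2 _ _ _ m), Uin2 m 1 = 1,
  {morph @Uin2 _ _ _ m : u v / u * v} & forall z, Uin2 m (Uin z) = Uin ((0, z) : dcross m)].
Proof. exact: Ulift_spec (dcross_in2_lie_map m). Qed.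

Lemma Umult_bilin : is_bilinear (fun a b => Uin1 m a * Uin2 m b).
Proof.
have [l1 _ _ _] := Uin1_spec; have [l2 _ _ _] := Uin2_spec.
by split=> u; [apply: mull_lin | apply: mulr_lin].
Qed.

Lemma Umult_lin : linear (@Umult _ _ _ m).
Proof. exact: swd_linear Umult_bilin. Qed.

Lemma Umult_pure a b : Umult m (a ⊗ b) = Uin1 m a * Uin2 m b.
Proof. exact: swd_pure Umult_bilin. Qed.

Lemma UinE (p : dcross m) : Uin p = Uin ((p.1, 0) : dcross m) + Uin ((0, p.2) : dcross m).
Proof.
rewrite -(linD (Uin_lie_map (dcross m)).1); congr Uin.
by case: p => X z; congr (_, _); rewrite /= ?addr0 ?add0r.
Qed.

(** The bracket of (0, z) and (X, 0) in the double crossed sum is (z ▷ X, z ◁ X). *)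
Lemma Uin_cross X z : Uin ((0, z) : dcross m) * Uin ((X, 0) : dcross m) =
  Uin ((z |> X, 0) : dcross m) + Uin ((X, 0) : dcross m) * Uin ((0, z) : dcross m)
  + Uin ((0, z <| X) : dcross m).
Proof.
apply/eqP; rewrite -addrAC -subr_eq -(Uin_lie_map (dcross m)).2; apply/eqP.
rewrite [LHS]UinE /= !(bil0l (@lie_bilinear _ _), bil0r (@lie_bilinear _ _)).
by rewrite !(bil0l (mlact_bilinear m), bil0l (mract_bilinear m)) !subr0 !add0r.
Qed.

Let Umult_lmul X t : Umult m (lmul X t) = Uin ((X, 0) : dcross m) * Umult m t.
Proof.
elim/tens_ind: t => [|a b t IH].
  by rewrite (bil0r lmul_bilin) (lin0 Umult_lin) mulr0.
rewrite (bilDr lmul_bilin) !(linD Umult_lin) mulrDr IH lmulE !Umult_pure.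
by have [_ _ -> ->] := Uin1_spec; rewrite mulrA.
Qed.

Let Umult_rmul z t : Umult m (rmul z t) = Uin ((0, z) : dcross m) * Umult m t.
Proof.
elim/tens_ind: t => [|a b t IH].
  by rewrite (bil0r rmul_bilin) (lin0 Umult_lin) mulr0.
rewrite (bilDr rmul_bilin) !(linD Umult_lin) mulrDr IH; congr (_ + _) => {t IH}.
elim/Uenv_ind: a z => [|c u v IHu IHv||X u IHu] z.
- by rewrite (bil0l (@tpure_bilinear K A B)) (bil0r rmul_bilin) (lin0 Umult_lin) mulr0.
- rewrite tpureDl tpureZl !(bilDr rmul_bilin, bilZr rmul_bilin) !Umult_lin.
  by rewrite IHu IHv mulrDr scalerAr.
- rewrite rmulE Phi1 !Umult_pure.
  have [_ -> _ _] := Uin1_spec; have [_ _ -> ->] := Uin2_spec.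
  by rewrite !mul1r.
- rewrite -lmulE rmul_lmul !(linD Umult_lin) IHu !Umult_lmul IHu.
  by rewrite !mulrA Uin_cross !mulrDl.
Qed.

Let Umult_dmul p t : Umult m (dmul p t) = Uin p * Umult m t.
Proof. by rewrite (linD Umult_lin) Umult_lmul Umult_rmul -mulrDl -UinE. Qed.

(** Equivariance of multiplication, [Umult_dmul], gives one cancellation by induction on [h]. For
    the other, U(g2) carries 1 ⊗ 1 to 1 ⊗ b, and U(g1) then carries 1 ⊗ b to a ⊗ b. *)
Lemma Umult_bij : exists theta : Uenv (dcross m) -> M,
  [/\ linear theta, cancel theta (Umult m) & cancel (Umult m) theta].
Proof.
have [dl _] := Uact_bilinear dmul_lie_module.
have [l1 U11 U1M U1X] := Uin1_spec; have [l2 U21 U2M U2X] := Uin2_spec.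
exists (fun h => Uact dmul_lie_module h (1 ⊗ 1)); split=> [|h|t]; first exact: dl.
  elim/Uenv_ind: h => [|c u v IHu IHv||p u IHu].
  - by rewrite (lin0 (dl _)) (lin0 Umult_lin).
  - by rewrite (dl _) Umult_lin IHu IHv.
  - by rewrite Uact1 Umult_pure U11 U21 mulr1.
  - by rewrite UactM UactX Umult_dmul IHu.
have H2 b : Uact dmul_lie_module (Uin2 m b) (1 ⊗ 1) = 1 ⊗ b.
  elim/Uenv_ind: b => [|c u v IHu IHv||z u IHu].
  - by rewrite (lin0 l2) (lin0 (dl _)) (bil0r (@tpure_bilinear K A B)).
  - by rewrite l2 (dl _) IHu IHv tpureDr tpureZr.
  - by rewrite U21 Uact1.
  - by rewrite U2M UactM U2X IHu UactX /dmul /= (bil0l lmul_bilin) add0r rmulE Phi1.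
have H1 a b : Uact dmul_lie_module (Uin1 m a) (1 ⊗ b) = a ⊗ b.
  elim/Uenv_ind: a => [|c u v IHu IHv||X u IHu].
  - by rewrite (lin0 l1) (lin0 (dl _)) (bil0l (@tpure_bilinear K A B)).
  - by rewrite l1 (dl _) IHu IHv tpureDl tpureZl.
  - by rewrite U11 Uact1.
  - by rewrite U1M UactM U1X IHu UactX /dmul /= (bil0l rmul_bilin) addr0 lmulE.
elim/tens_ind: t => [|a b t IH]; first by rewrite (lin0 Umult_lin) (lin0 (dl _)).
by rewrite (linD Umult_lin) (linD (dl _)) IH Umult_pure UactM H2 H1.
Qed.

End DoubleCrossModule.

(** * Factorized Hopf algebras *)

Record bialg_map (K : fieldType) (A H : hopfAlgType K) (f : A -> H) : Prop := {
  bialg_lin : linear f;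
  bialg1 : f 1 = 1;
  bialgM : {morph f : x y / x * y};
  bialg_comul : forall a, comul (f a) = \sw_(x, y <- comul a) (f x ⊗ f y);
  bialg_counit : forall a, counit (f a) = counit a
}.

(** The identities between the mutual actions of the two factors of a double cross product: each is
    an action and a coalgebra map, and each is multiplicative up to a twist by the other. The
    constructions on representative functions apply to any such pair. *)
Record matched_actions (K : fieldType) (A B : hopfAlgType K)
    (la : B -> A -> A) (ra : B -> A -> B) : Prop := {
  lact_bilinear : is_bilinear la;
  ract_bilinear : is_bilinear ra;
  lact1l : forall u, la 1 u = u;
  lact1r : forall v, la v 1 = (counit v)%:A;
  ract1l : forall u, ra 1 u = (counit u)%:A;
  ract1r : forall v, ra v 1 = v;
  lactM : forall v w u, la (v * w) u = la v (la w u);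
  ractM : forall v u w, ra v (u * w) = ra (ra v u) w;
  lactMr : forall v u w, la v (u * w) =
    \sw_(v1, v2 <- comul v) \sw_(u1, u2 <- comul u) (la v1 u1 * la (ra v2 u2) w);
  ractMl : forall v w u, ra (v * w) u =
    \sw_(w1, w2 <- comul w) \sw_(u1, u2 <- comul u) (ra v (la w1 u1) * ra w2 u2);
  lact_comul : forall v u, comul (la v u) =
    \sw_(v1, v2 <- comul v) \sw_(u1, u2 <- comul u) (la v1 u1 ⊗ la v2 u2);
  ract_comul : forall v u, comul (ra v u) =
    \sw_(v1, v2 <- comul v) \sw_(u1, u2 <- comul u) (ra v1 u1 ⊗ ra v2 u2);
  lact_counit : forall v u, counit (la v u) = counit v * counit u;
  ract_counit : forall v u, counit (ra v u) = counit v * counit u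
}.

Section CoalgebraSums.
Variables (K : fieldType).

Lemma swd_comulr (A : hopfAlgType K) (Z : lmodType K) (F : A -> Z) a : linear F ->
  \sw_(x, y <- comul a) (counit y *: F x) = F a.
Proof.
move=> lF; rewrite -[in RHS](counitr a) (lin_swd _ _ lF).
by apply: eq_swd => x y; rewrite (linZ lF).
Qed.

Lemma swd_comull (A : hopfAlgType K) (Z : lmodType K) (F : A -> Z) a : linear F ->
  \sw_(x, y <- comul a) (counit x *: F y) = F a.
Proof.
move=> lF; rewrite -[in RHS](counitl a) (lin_swd _ _ lF).
by apply: eq_swd => x y; rewrite (linZ lF).
Qed.

Lemma swd_comul_mul (A B H : hopfAlgType K) (f : A -> H) (g : B -> H)
  (Z : lmodType K) (F : H -> H -> Z) a b :
  bialg_map f -> bialg_map g -> is_bilinear F ->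
  \sw_(x, y <- comul (f a * g b)) F x y =
  \sw_(a1, a2 <- comul a) \sw_(b1, b2 <- comul b) F (f a1 * g b1) (f a2 * g b2).
Proof.
move=> fP gP bF; rewrite comulM swd_mul // (bialg_comul fP) (bialg_comul gP).
have [F1 F2] := bF; have lf := bialg_lin fP; have lg := bialg_lin gP.
set G := fun x y : H => _.
have lG : is_bilinear G by split=> u; rewrite /G; apply: swd_linearF => v w;
  [apply: (comp_linear (f := F^~ _)) | apply: comp_linear] => //; lin.
rewrite (lin_swd _ _ (swd_linear lG)); apply: eq_swd => a1 a2.
rewrite swd_pure // /G.
have bG' : is_bilinear (fun v w => F (f a1 * v) (f a2 * w)).
  by split=> u; [apply: (comp_linear (f := F^~ _)) | apply: comp_linear] => //; lin.
rewrite (lin_swd _ _ (swd_linear bG')); apply: eq_swd => b1 b2.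
by rewrite swd_pure.
Qed.

End CoalgebraSums.

Section Factorization.
Variables (K : fieldType) (A B H : hopfAlgType K).
Variables (i1 : A -> H) (i2 : B -> H) (theta : H -> tens A B).
Hypotheses (i1P : bialg_map i1) (i2P : bialg_map i2).
Hypothesis theta_lin : linear theta.
Hypothesis thetaK : forall h, \sw_(a, b <- theta h) (i1 a * i2 b) = h.
Hypothesis thetaM : forall a b, theta (i1 a * i2 b) = a ⊗ b.

Let l1 := bialg_lin i1P.
Let l2 := bialg_lin i2P.
Let eA := @counit_linear K A.
Let eB := @counit_linear K B.
Let eH := @counit_linear K H.
Let dA := @comul_linear K A.
Let dB := @comul_linear K B.
Let dH := @comul_linear K H.

Definition projl (h : H) : A := \sw_(a, b <- theta h) (counit b *: a).
Definition projr (h : H) : B := \sw_(a, b <- theta h) (counit a *: b).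

Let er_bilin : is_bilinear (fun (a : A) (b : B) => counit b *: a).
Proof. by bilin. Qed.
Let el_bilin : is_bilinear (fun (a : A) (b : B) => counit a *: b).
Proof. by bilin. Qed.

Lemma projl_lin : linear projl.
Proof. exact: swdt_lin. Qed.
Lemma projr_lin : linear projr.
Proof. exact: swdt_lin. Qed.
Let pl := projl_lin.
Let pr := projr_lin.

Lemma projlE a b : projl (i1 a * i2 b) = counit b *: a.
Proof. by rewrite /projl thetaM swd_pure. Qed.
Lemma projrE a b : projr (i1 a * i2 b) = counit a *: b.
Proof. by rewrite /projr thetaM swd_pure. Qed.

(** By [thetaK] the products [i1 a * i2 b] span [H]. *)
Lemma factor_ext (Z : lmodType K) (F G : H -> Z) : linear F -> linear G ->
  (forall a b, F (i1 a * i2 b) = G (i1 a * i2 b)) -> F =1 G.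
Proof.
move=> lF lG FG h; rewrite -(thetaK h) !(lin_swd _ _ lF, lin_swd _ _ lG).
by apply: eq_swd => a b.
Qed.

Lemma projl_mull a h : projl (i1 a * h) = a * projl h.
Proof.
move: h; apply: factor_ext => [||a' b]; [lin | lin |].
by rewrite mulrA -(bialgM i1P) !projlE scalerAr.
Qed.

Lemma projl_mulr b h : projl (h * i2 b) = counit b *: projl h.
Proof.
move: h; apply: factor_ext => [||a b']; [lin | lin |].
by rewrite -mulrA -(bialgM i2P) !projlE counitM scalerA mulrC.
Qed.

Lemma projr_mulr b h : projr (h * i2 b) = projr h * b.
Proof.
move: h; apply: factor_ext => [||a b']; [lin | lin |].
by rewrite -mulrA -(bialgM i2P) !projrE scalerAl.
Qed.

Lemma projr_mull a h : projr (i1 a * h) = counit a *: projr h.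
Proof.
move: h; apply: factor_ext => [||a' b]; [lin | lin |].
by rewrite mulrA -(bialgM i1P) !projrE counitM scalerA.
Qed.

(** For h = a b the sum is that of ε(b1) a1 ε(a2) b2, which the counit axioms collapse to a b. *)
Lemma factorK h : \sw_(x, y <- comul h) (i1 (projl x) * i2 (projr y)) = h.
Proof.
have b12 : is_bilinear (fun x y => i1 (projl x) * i2 (projr y)) by bilin.
move: h; apply: factor_ext => [||a b]; [exact: swdt_lin | by [] |].
rewrite (swd_comul_mul _ _ i1P i2P) //.
under eq_swd do under eq_swd do rewrite projlE projrE (linZ l1) (linZ l2).
under eq_swd do under eq_swd do rewrite -scalerAl -scalerAr scalerA mulrC -scalerA.
under eq_swd do rewrite -(lin_swd _ _ (scaler_lin _ (@id_lin K H))).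
under eq_swd => a1 a2 do rewrite (swd_comull b (mulr_lin (i1 a1) l2)).
by rewrite (swd_comulr a (mull_lin (i2 b) l1)).
Qed.

Lemma projl_comul h : comul (projl h) = \sw_(x, y <- comul h) (projl x ⊗ projl y).
Proof.
have bp : is_bilinear (fun x y => projl x ⊗ projl y) by bilin.
move: h; apply: factor_ext => [||a b]; [lin | exact: swdt_lin |].
rewrite (swd_comul_mul _ _ i1P i2P) // projlE (linZ dA).
under eq_swd do under eq_swd do rewrite !projlE tpureZl tpureZr.
under eq_swd => a1 a2 do rewrite (swd_comull b (scalel_lin (a1 ⊗ a2) eB)).
by rewrite -(lin_swd _ _ (scaler_lin _ (@id_lin K (tens A A)))) -tens_sum.
Qed.

Lemma projr_comul h : comul (projr h) = \sw_(x, y <- comul h) (projr x ⊗ projr y).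
Proof.
have bp : is_bilinear (fun x y => projr x ⊗ projr y) by bilin.
move: h; apply: factor_ext => [||a b]; [lin | exact: swdt_lin |].
rewrite (swd_comul_mul _ _ i1P i2P) // projrE (linZ dB) swd_exchange.
under eq_swd do under eq_swd do rewrite !projrE tpureZl tpureZr.
under eq_swd => b1 b2 do rewrite (swd_comull a (scalel_lin (b1 ⊗ b2) eA)).
by rewrite -(lin_swd _ _ (scaler_lin _ (@id_lin K (tens B B)))) -tens_sum.
Qed.

Lemma projl_counit h : counit (projl h) = counit h.
Proof.
move: h; apply: (factor_ext (Z := K^o)) => [||a b] //.
  by move=> c x y; rewrite pl eA.
by rewrite projlE (scalZ eA) counitM !(bialg_counit i1P, bialg_counit i2P) mulrC.
Qed.

Lemma projr_counit h : counit (projr h) = counit h.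
Proof.
move: h; apply: (factor_ext (Z := K^o)) => [||a b] //.
  by move=> c x y; rewrite pr eB.
by rewrite projrE (scalZ eB) counitM !(bialg_counit i1P, bialg_counit i2P).
Qed.

Definition fact_lact (v : B) (u : A) : A := projl (i2 v * i1 u).
Definition fact_ract (v : B) (u : A) : B := projr (i2 v * i1 u).
Local Notation "v |> u" := (fact_lact v u) (at level 40).
Local Notation "v <| u" := (fact_ract v u) (at level 40).

Lemma fact_lact_bilin : is_bilinear fact_lact.
Proof. by rewrite /fact_lact; bilin. Qed.
Lemma fact_ract_bilin : is_bilinear fact_ract.
Proof. by rewrite /fact_ract; bilin. Qed.
Let labl u := fact_lact_bilin.1 u.
Let labr v := fact_lact_bilin.2 v.
Let rabl u := fact_ract_bilin.1 u.
Let rabr v := fact_ract_bilin.2 v.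

Lemma fact_lact1l u : 1 |> u = u.
Proof.
by rewrite /fact_lact (bialg1 i2P) mul1r -[i1 u]mulr1 -(bialg1 i2P) projlE counit1 scale1r.
Qed.
Lemma fact_lact1r v : v |> 1 = (counit v)%:A.
Proof.
by rewrite /fact_lact (bialg1 i1P) mulr1 -[i2 v]mul1r -(bialg1 i1P) projlE.
Qed.
Lemma fact_ract1l u : 1 <| u = (counit u)%:A.
Proof.
by rewrite /fact_ract (bialg1 i2P) mul1r -[i1 u]mulr1 -(bialg1 i2P) projrE.
Qed.
Lemma fact_ract1r v : v <| 1 = v.
Proof.
by rewrite /fact_ract (bialg1 i1P) mulr1 -[i2 v]mul1r -(bialg1 i1P) projrE counit1 scale1r.
Qed.

(** On h = a b both sides are ε(b) (v ▷ a). The action law of ▷ follows, and [projr_ract] plays the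
    same part for ◁. *)
Lemma projl_lact v h : projl (i2 v * h) = v |> projl h.
Proof.
have lv := labr v.
move: h; apply: factor_ext => [||a b]; [lin | lin |].
by rewrite mulrA projl_mulr projlE (linZ lv).
Qed.
Lemma projr_ract u h : projr (h * i1 u) = projr h <| u.
Proof.
have lu := rabl u.
move: h; apply: factor_ext => [||a b]; [lin | exact: comp_linear lu pr |].
by rewrite -mulrA projr_mull projrE (linZ lu).
Qed.

Lemma fact_lactM v w u : (v * w) |> u = v |> (w |> u).
Proof. by rewrite {1}/fact_lact (bialgM i2P) -mulrA projl_lact. Qed.
Lemma fact_ractM v u w : v <| (u * w) = (v <| u) <| w.
Proof. by rewrite {1}/fact_ract (bialgM i1P) mulrA projr_ract. Qed.

(** This is [factorK] at h = v u, whose coproduct is v1 u1 ⊗ v2 u2. Multiplying by one more factor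
    and projecting yields the twisted product rules. *)
Lemma fact_cross v u : i2 v * i1 u =
  \sw_(v1, v2 <- comul v) \sw_(u1, u2 <- comul u) (i1 (v1 |> u1) * i2 (v2 <| u2)).
Proof.
rewrite -[LHS]factorK (swd_comul_mul _ _ i2P i1P) //.
by bilin.
Qed.

Lemma fact_lactMr v u w : v |> (u * w) =
  \sw_(v1, v2 <- comul v) \sw_(u1, u2 <- comul u) ((v1 |> u1) * ((v2 <| u2) |> w)).
Proof.
rewrite {1}/fact_lact (bialgM i1P) mulrA fact_cross.
have lw := pl; have lm := mull_lin (i1 w) (@id_lin K H).
rewrite (lin_swd _ _ lm) (lin_swd _ _ lw); apply: eq_swd => v1 v2.
rewrite (lin_swd _ _ lm) (lin_swd _ _ lw); apply: eq_swd => u1 u2.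
by rewrite -mulrA projl_mull.
Qed.

Lemma fact_ractMl v w u : (v * w) <| u =
  \sw_(w1, w2 <- comul w) \sw_(u1, u2 <- comul u) ((v <| (w1 |> u1)) * (w2 <| u2)).
Proof.
rewrite {1}/fact_ract (bialgM i2P) -mulrA fact_cross.
have lw := pr; have lm := mulr_lin (i2 v) (@id_lin K H).
rewrite (lin_swd _ _ lm) (lin_swd _ _ lw); apply: eq_swd => v1 v2.
rewrite (lin_swd _ _ lm) (lin_swd _ _ lw); apply: eq_swd => u1 u2.
by rewrite mulrA projr_mulr.
Qed.

Lemma fact_lact_comul v u : comul (v |> u) =
  \sw_(v1, v2 <- comul v) \sw_(u1, u2 <- comul u) ((v1 |> u1) ⊗ (v2 |> u2)).
Proof. by rewrite projl_comul (swd_comul_mul _ _ i2P i1P) //; bilin. Qed.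
Lemma fact_ract_comul v u : comul (v <| u) =
  \sw_(v1, v2 <- comul v) \sw_(u1, u2 <- comul u) ((v1 <| u1) ⊗ (v2 <| u2)).
Proof. by rewrite projr_comul (swd_comul_mul _ _ i2P i1P) //; bilin. Qed.

Lemma fact_lact_counit v u : counit (v |> u) = counit v * counit u.
Proof. by rewrite projl_counit counitM !(bialg_counit i1P, bialg_counit i2P). Qed.
Lemma fact_ract_counit v u : counit (v <| u) = counit v * counit u.
Proof. by rewrite projr_counit counitM !(bialg_counit i1P, bialg_counit i2P). Qed.

Lemma fact_actions : matched_actions fact_lact fact_ract.
Proof.
split; [exact: fact_lact_bilin | exact: fact_ract_bilin | exact: fact_lact1l
  | exact: fact_lact1r | exact: fact_ract1l | exact: fact_ract1r | exact: fact_lactM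
  | exact: fact_ractM | exact: fact_lactMr | exact: fact_ractMl | exact: fact_lact_comul
  | exact: fact_ract_comul | exact: fact_lact_counit | exact: fact_ract_counit].
Qed.

End Factorization.

(** * The factorization of U(g1 ⋈ g2) and the resulting actions *)

Section EnvelopingFactorization.
Variables (K : fieldType).

(** Coproducts and counits are algebra morphisms, so it suffices to compare them on generators,
    which are primitive and are sent to generators. *)
Lemma Ulift_bialg (g h : lieAlgType K) (f : g -> h) : lie_map (fun x => Uin (f x)) ->
  bialg_map (Ulift (fun x => Uin (f x)) : Uenv g -> Uenv h).
Proof.
move=> fP; have [Fl F1 FM FX] := Ulift_spec fP; set F := Ulift _ in Fl F1 FM FX *.
have dg := @comul_linear K (Uenv g); have dh := @comul_linear K (Uenv h).
have eg := @counit_linear K (Uenv g); have eh := @counit_linear K (Uenv h).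
split=> // a.
  have bG : is_bilinear (fun x y => F x ⊗ F y) by bilin.
  pose G t := \sw_(x, y <- t) (F x ⊗ F y); have Gl : linear G by apply: swd_linear.
  have Gp x y : G (x ⊗ y) = F x ⊗ F y by rewrite /G swd_pure.
  have GM : {morph G : s t / s * t}.
    apply: tens_mult => [|x y z w]; first exact: linD.
    by rewrite !Gp !FM tensM.
  rewrite -/(G _); elim/Uenv_ind: a => [|c u v IHu IHv||x u IHu].
  - by rewrite (lin0 Fl) (lin0 dg) (lin0 dh) (lin0 Gl).
  - by rewrite Fl dg dh Gl IHu IHv.
  - by rewrite F1 !comul1 Gp F1.
  - by rewrite FM !comulM GM IHu FX !comulX (linD Gl) !Gp F1 FX.
elim/Uenv_ind: a => [|c u v IHu IHv||x u IHu].
- by rewrite (lin0 Fl) (scal0 eg) (scal0 eh).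
- by rewrite Fl eg eh IHu IHv.
- by rewrite F1 !counit1.
- by rewrite FM !counitM FX !counitX !mul0r.
Qed.

Variables (g1 g2 : lieAlgType K) (m : lieMatchedPair g1 g2).

Lemma Upsi_factorization : exists theta : Uenv (dcross m) -> tens (Uenv g1) (Uenv g2),
  [/\ linear theta, forall h, \sw_(a, b <- theta h) (Uin1 m a * Uin2 m b) = h,
      forall a b, theta (Uin1 m a * Uin2 m b) = a ⊗ b
    & forall v u, Upsi m v u = theta (Uin2 m v * Uin1 m u)].
Proof.
have [theta [tl tK Kt]] := Umult_bij m; exists theta; split=> // [a b|v u].
  by rewrite -(Kt (a ⊗ b)) Umult_pure.
(* Either [xget] returns a preimage, which [theta] recovers, or there is none, contradicted by
   [theta] of the product. *)
rewrite /Upsi; case: xgetP => [t _ <-|/(_ (theta (Uin2 m v * Uin1 m u))) []].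
  by rewrite Kt.
exact: tK.
Qed.

Lemma Uenv_matched_actions : matched_actions (Ulact m) (Uract m).
Proof.
have [theta [tl tK Kt psiE]] := Upsi_factorization.
have P1 : bialg_map (Uin1 m) := Ulift_bialg (dcross_in1_lie_map m).
have P2 : bialg_map (Uin2 m) := Ulift_bialg (dcross_in2_lie_map m).
have -> : Ulact m = fact_lact (Uin1 m) (Uin2 m) theta.
  by apply/funext => v; apply/funext => u; rewrite /Ulact psiE.
have -> : Uract m = fact_ract (Uin1 m) (Uin2 m) theta.
  by apply/funext => v; apply/funext => u; rewrite /Uract psiE.
exact: fact_actions.
Qed.

(** Project z X = z ▷ X + X z + z ◁ X onto U(g1): the counit kills the last two terms. *)
Lemma Ulact_UinUin z X : Ulact m (Uin z) (Uin X) = Uin (mlact m z X).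
Proof.
have [theta [tl tK Kt psiE]] := Upsi_factorization.
have [_ U11 _ U1X] := Uin1_spec m; have [_ U21 _ U2X] := Uin2_spec m.
rewrite /Ulact psiE -/(projl theta _).
have -> : Uin2 m (Uin z) * Uin1 m (Uin X) = Uin1 m (Uin (mlact m z X)) * Uin2 m 1
    + Uin1 m (Uin X) * Uin2 m (Uin z) + Uin1 m 1 * Uin2 m (Uin (mract m z X)).
  by rewrite U11 U21 !U1X !U2X mulr1 mul1r Uin_cross.
have pl : linear (projl theta) := projl_lin tl.
by rewrite !(linD pl) !(projlE Kt) !counitX counit1 !scale0r scale1r !addr0.
Qed.

(** The action of U(g2) keeps [g1] stable: [lam] is the action induced by the Lie module [mlact],
    and the two agree on generators of U(g2). *)
Lemma Ulact_Uin : exists lam : Uenv g2 -> g1 -> g1,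
  [/\ is_bilinear lam, forall v w X, lam (v * w) X = lam v (lam w X)
    & forall v X, Ulact m v (Uin X) = Uin (lam v X)].
Proof.
have mP : lie_module (mlact m) by split; [exact: mlact_bilinear | exact: mlact_lie].
have ul := (Uin_lie_map g1).1; have [lb _] := lact_bilinear Uenv_matched_actions.
exists (Uact mP); split=> [|v w X|v X]; [exact: Uact_bilinear | exact: UactM |].
elim/Uenv_ind: v X => [|c u v IHu IHv||z u IHu] X.
- by rewrite (bil0l (Uact_bilinear mP)) (lin0 ul) (lin0 (lb _)).
- by rewrite (lb _) /= IHu IHv ((Uact_bilinear mP).1 X) ul.
- by rewrite Uact1 (lact1l Uenv_matched_actions).
- by rewrite UactM UactX (lactM Uenv_matched_actions) IHu Ulact_UinUin.
Qed.

End EnvelopingFactorization.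

(** * Evaluation of representative functions *)

(* A functional is representative as soon as its translates h(- w) span a finite
   dimensional space: the witness is the annihilator of the module they generate. *)
Lemma representative_translates (K : fieldType) (g : lieAlgType K) (h : Uenv g -> K)
    (T : finType) (p : T -> Uenv g -> K) :
  scalar h -> (forall i, scalar (p i)) ->
  (forall w, (forall i, p i w = 0) -> forall v, h (v * w) = 0) -> representative h.
Proof.
move=> hl pl ph.
pose J := [set w | forall v, h (v * w) = 0]%classic.
have [n [s hs]] : fin_codim J by apply: (fin_codim_ker pl) => w /ph.
split=> //; exists [set u | forall a b, h (a * u * b) = 0]%classic; split.
- split; first split=> [a b|c u v hu hv a b] /=.
  + by rewrite mulr0 mul0r (scal0 hl).
  + by rewrite mulrDr mulrDl -scalerAr -scalerAl hl hu hv mulr0 addr0.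
  + move=> a x hx; split=> b c /=; first by rewrite mulrA hx.
    by rewrite mulrA -mulrA hx.
- apply: (@fin_codim_ker _ _ (T * 'I_n)%type (fun ik u => p ik.1 (u * s ik.2))).
    by move=> ik; apply: mulr_scalar.
  (* Modulo [J] every [b] is a combination of the [s k], and the conditions on [u] put each
     [u * s k] in [J]. *)
  move=> u pu a b /=; have [c hc] := hs b.
  have Ju k : J (u * s k) by apply: ph => i; exact: (pu (i, k)).
  rewrite -[b](subrK (\sum_(i < n) c i *: s i)) mulrDr (scalD hl) hc add0r.
  rewrite mulr_sumr (scal_sum hl) big1 // => k _.
  by rewrite -scalerAr (scalZ hl) -mulrA (Ju k) mulr0.
- by move=> u /(_ 1 1); rewrite mul1r mulr1.
Qed.

(** * Separation of tensors by evaluating the second factor *)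

Section TensorEvaluation.
Variables (K : fieldType) (V W : lmodType K) (T : Type) (e : W -> T -> K).
Hypothesis el : forall b, scalar (e^~ b).
Hypothesis e0 : forall w, (forall b, e w b = 0) -> w = 0.

Definition tens_ev (b : T) (t : tens V W) : V := \sw_(v, w <- t) (e w b *: v).

Lemma tens_ev_bilin b : is_bilinear (fun (v : V) (w : W) => e w b *: v).
Proof. by split=> u; [apply: scaler_lin | exact: scalel_lin]. Qed.

Lemma tens_ev_lin b : linear (tens_ev b).
Proof. exact: swd_linear (tens_ev_bilin b). Qed.

Lemma tens_ev_pure b v w : tens_ev b (v ⊗ w) = e w b *: v.
Proof. exact: swd_pure (tens_ev_bilin b). Qed.

(** Induction on the length of a representing list. A nonzero leading [w] is detected by some [b0];
    evaluation at [b0] expresses [v] through the remaining first factors, and substituting shortens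
    the list. *)
Lemma tens_ev_eq0 (t : tens V W) : (forall b, tens_ev b t = 0) -> t = 0.
Proof.
rewrite /tens_ev [t in t = 0]tens_sum /swd /teval; move: (repr t) => s {t}.
elim: {s}(size s) {-2}s (erefl (size s)) => [|n IH] [|[v w] s] //= => [_ _|[sn] hs].
  by rewrite big_nil.
rewrite big_cons /=.
case: (pselect (exists b, e w b != 0)) => [[b0 kb]|nb]; last first.
  have w0 : w = 0.
    by apply: e0 => b; apply/eqP/negPn/negP => h; apply: nb; exists b.
  rewrite w0 (bil0r (@tpure_bilinear K V W)) add0r; apply: IH => // b.
  by have := hs b; rewrite big_cons /= w0 (scal0 (el b)) scale0r add0r.
pose c (p : V * W) := e p.2 b0 / e w b0.
have vE : v = - \sum_(p <- s) c p *: p.1.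
  apply/eqP; rewrite -addr_eq0; apply/eqP.
  have := hs b0; rewrite big_cons /= => /(congr1 (fun x => (e w b0)^-1 *: x)).
  rewrite scaler0 scalerDr scalerA mulVf // scale1r scaler_sumr => E.
  by rewrite -[RHS]E; congr (_ + _); apply: eq_bigr => p _; rewrite scalerA mulrC.
have -> : v ⊗ w + \sum_(p <- s) p.1 ⊗ p.2 =
    \sum_(p <- [seq (p.1, p.2 - c p *: w) | p <- s]) p.1 ⊗ p.2.
  rewrite big_map vE tpureNl tpure_suml addrC -sumrB.
  by apply: eq_bigr => p _; rewrite tpureBr tpureZr tpureZl.
apply: IH; first by rewrite size_map.
move=> b; rewrite big_map /=; apply: etrans (hs b); rewrite big_cons /=.
rewrite [in RHS]vE scalerN addrC scaler_sumr -sumrB.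
apply: eq_bigr => p _.
by rewrite (scalB (el b)) scalerBl (scalZ (el b)) scalerA [c p * _]mulrC.
Qed.

Lemma tens_ev_inj (s t : tens V W) : (forall b, tens_ev b s = tens_ev b t) -> s = t.
Proof.
move=> h; apply/eqP; rewrite -subr_eq0; apply/eqP/tens_ev_eq0 => b.
by rewrite (linB (tens_ev_lin b)) h subrr.
Qed.

End TensorEvaluation.

Section ReprEvaluation.
Variables (K : fieldType) (g : lieAlgType K).
Local Notation U := (Uenv g).
Local Notation R := (reprfun g).

Lemma reprfun_evl (u : U) : scalar (fun f : R => f u).
Proof. by []. Qed.

Lemma comul_reprE (f : R) u v : \sw_(a, b <- comul f) (a u * b v : K^o) = f (u * v).
Proof. exact: reprfun_comulE. Qed.

Lemma counit_reprE (f : R) : counit f = f 1.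
Proof. by []. Qed.

Definition rev (V : lmodType K) (u : U) (t : tens V R) : V :=
  tens_ev (fun (f : R) u => f u) u t.

Lemma rev_lin (V : lmodType K) u : linear (@rev V u).
Proof. by apply: tens_ev_lin; exact: reprfun_evl. Qed.

Lemma rev_pure (V : lmodType K) u v f : @rev V u (v ⊗ f) = f u *: v.
Proof. by apply: tens_ev_pure; exact: reprfun_evl. Qed.

Lemma rev_inj (V : lmodType K) (s t : tens V R) : (forall u, rev u s = rev u t) -> s = t.
Proof.
apply: tens_ev_inj; first exact: reprfun_evl.
by move=> f f0; apply: reprfun_ext.
Qed.

Lemma swd_scalel (A B : lmodType K) (V : lmodType K) (t : tens A B) (F : A -> B -> K^o)
  (v : V) : (swd t F : K) *: v = \sw_(a, b <- t) ((F a b : K) *: v).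
Proof.
by apply: (lin_swd (f := fun x : K^o => (x : K) *: v)) => c x y; rewrite scalerDl -scalerA.
Qed.

Lemma swd_scaler (A B V : lmodType K) (t : tens A B) (F : A -> B -> V) (c : K) :
  \sw_(a, b <- t) (c *: F a b) = c *: swd t F.
Proof. exact: esym (scaler_sumr _ _ _ _). Qed.

(** Representative functions multiply by convolution, so evaluating [f * h] at [u] splits along the
    coproduct of [u]. *)
Lemma rev_conv (V W Z : lmodType K) (G : V -> W -> Z) (u : U) (s : tens V R) (t : tens W R) :
  is_bilinear G ->
  \sw_(a, f <- s) \sw_(b, h <- t) ((f * h) u *: G a b) =
  \sw_(x, y <- comul u) G (rev x s) (rev y t).
Proof.
move=> bG.
under eq_swd do under eq_swd do rewrite reprfunEM swd_scalel.
under eq_swd do rewrite swd_exchange.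
rewrite swd_exchange; apply: eq_swd => x y.
rewrite /rev /tens_ev (lin_swd _ _ (bG.1 _)); apply: eq_swd => a f.
rewrite (lin_swd _ _ (bG.2 _)); apply: eq_swd => b h.
by rewrite (bilZl bG) (bilZr bG) scalerA.
Qed.

Lemma rev_mul (A : algType K) (u : U) (s t : tens A R) :
  rev u (s * t) = \sw_(x, y <- comul u) (rev x s * rev y t).
Proof.
rewrite -rev_conv; last by split=> w; [apply: mull_lin | apply: mulr_lin].
by rewrite [LHS]swd_mul //; apply: tens_ev_bilin; exact: reprfun_evl.
Qed.

Lemma rev_comp (V : lmodType K) (F : R -> R) (phi : U -> U) (t : tens V R) v :
  (forall f u, F f u = f (phi u)) -> rev v (\sw_(b, h <- t) (b ⊗ F h)) = rev (phi v) t.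
Proof.
move=> FE; rewrite (lin_swd _ _ (@rev_lin _ v)).
by apply: eq_swd => b h; rewrite rev_pure FE.
Qed.

Lemma rev_assoc (V W : lmodType K) u (t : tens V W) (f : R) :
  rev u (\sw_(v, w <- t) (v ⊗ w ⊗ f)) = f u *: t.
Proof.
rewrite (lin_swd _ _ (@rev_lin _ u)); under eq_swd do rewrite rev_pure.
by rewrite swd_scaler -tens_sum.
Qed.

Lemma rev_comul u v (f : R) : rev v (comul f) u = f (u * v).
Proof.
rewrite -comul_reprE /rev /tens_ev (lin_swd (f := fun h : R => h u : K^o)) //.
by apply: (eq_swd (Z := K^o)) => a b; rewrite reprfunEZ mulrC.
Qed.

End ReprEvaluation.

(** * The matched pair of Hopf algebras *)

Section RepresentativeActions.
Variables (K : fieldType) (g1 g2 : lieAlgType K).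
Local Notation A := (Uenv g1).
Local Notation B := (Uenv g2).
Local Notation R := (reprfun g2).
Variables (la : B -> A -> A) (ra : B -> A -> B).
Hypothesis lraP : matched_actions la ra.
Hypothesis la_fin : forall x : g1, exists n (c : 'I_n -> R) (y : 'I_n -> A),
  forall v, la v (Uin x) = \sum_(j < n) c j v *: y j.

Let labl u := (lact_bilinear lraP).1 u.
Let labr v := (lact_bilinear lraP).2 v.
Let rabl u := (ract_bilinear lraP).1 u.
Let rabr v := (ract_bilinear lraP).2 v.

Lemma swd_split (V W Z : lmodType K) (t : tens V W) (F G : V -> W -> Z) :
  \sw_(a, b <- t) (F a b + G a b) = swd t F + swd t G.
Proof. exact: big_split. Qed.

Lemma swd_comulX (g : lieAlgType K) (Z : lmodType K) (F : Uenv g -> Uenv g -> Z) x :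
  is_bilinear F -> \sw_(a, b <- comul (Uin x)) F a b = F (Uin x) 1 + F 1 (Uin x).
Proof. by move=> bF; rewrite comulX (linD (swd_linear bF)) !swd_pure. Qed.

(** As [x] is primitive, [lactMr] has two summands; the one from 1 ⊗ x is ε(v1) (v2 ◁ x) ▷ u,
    contracted by the counit axiom. *)
Lemma lact_Uin_mul v x u : la v (Uin x * u) =
  \sw_(v1, v2 <- comul v) (la v1 (Uin x) * la v2 u) + la (ra v (Uin x)) u.
Proof.
rewrite (lactMr lraP).
under eq_swd => v1 v2.
  rewrite swd_comulX; last first.
    split=> w; first exact: mull_lin (labr v1).
    exact: mulr_lin (comp_linear (labl u) (rabr v2)).
  rewrite (ract1r lraP) (lact1r lraP) -scalerAl mul1r.
over.
rewrite swd_split; congr (_ + _).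
exact: swd_comull (comp_linear (labl u) (rabl (Uin x))).
Qed.

Lemma ract_mul_Uin v w x : ra (v * w) (Uin x) =
  \sw_(w1, w2 <- comul w) (ra v (la w1 (Uin x)) * w2) + v * ra w (Uin x).
Proof.
rewrite (ractMl lraP).
under eq_swd => w1 w2.
  rewrite swd_comulX; last first.
    split=> u; first exact: mull_lin (comp_linear (rabr v) (labr w1)).
    exact: mulr_lin (rabr w2).
  rewrite (ract1r lraP) (lact1r lraP) (linZ (rabr v)) (ract1r lraP) -scalerAl.
over.
rewrite swd_split; congr (_ + _).
exact: swd_comull (mulr_lin v (rabl (Uin x))).
Qed.

(** Let f1 ⊗ f2 run through the coproduct of [f]. By [ract_mul_Uin], f((v w) ◁ x) is a sum of terms
    f1(v ◁ y_j) (c_j f2)(w) and f1(v) f2(w ◁ x). The finitely many functionals c_j f2 and f2(- ◁ x)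
    of [w] therefore control all translates. *)
Lemma representative_ract_Uin (f : R) x : representative (fun v => f (ra v (Uin x))).
Proof.
have [n [c [y cE]]] := la_fin x.
have fl := reprfun_lin f; set s := repr (comul f).
have fM a b : f (a * b) = \sum_(k < size s) (s`_k).1 a * (s`_k).2 b.
  by rewrite -comul_reprE /swd /teval (big_nth 0) big_mkord.
pose p (i : 'I_(size s) * 'I_n + 'I_(size s)) (w : B) : K :=
  match i with
  | inl kj => conv (c kj.2) (s`_kj.1).2 w
  | inr k => (s`_k).2 (ra w (Uin x))
  end.
apply: (representative_translates (p := p)) => [a u v|[[k j]|k]|w pw v].
- by rewrite (rabl (Uin x)) fl.
- by apply: conv_lin; exact: reprfun_lin.
- by move=> a u v /=; rewrite (rabl (Uin x)) reprfun_lin.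
rewrite ract_mul_Uin (scalD fl) [X in _ + X]fM [X in _ + X]big1 => [|k _]; last first.
  by have /= -> := pw (inr k); rewrite mulr0.
rewrite addr0 (lin_swd _ _ (reprfun_linear f)).
transitivity (\sw_(w1, w2 <- comul w) (\sum_(k < size s) \sum_(j < n)
    ((s`_k).1 (ra v (y j)) *: (c j w1 * (s`_k).2 w2 : K^o)))).
  apply: (eq_swd (Z := K^o)) => w1 w2; rewrite fM; apply: eq_bigr => k _.
  rewrite cE (lin_sum (rabr v)) (scal_sum (reprfun_lin (s`_k).1)) mulr_suml.
  apply: eq_bigr => j _.
  rewrite (linZ (rabr v)) (scalZ (reprfun_lin (s`_k).1)).
  by rewrite -mulrA mulrCA.
rewrite /swd /teval exchange_big big1 // => k _.
rewrite exchange_big big1 // => j _.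
rewrite -scaler_sumr.
by have := pw (inl (k, j)); rewrite /= /conv /swd /teval => ->; rewrite scaler0.
Qed.

Lemma representative_ract (f : R) u : representative (fun v => f (ra v u)).
Proof.
elim/Uenv_ind: u f => [|c u w IHu IHw||x u IHu] f.
- have := representative_zero g2; congr representative; apply/funext => v.
  by rewrite (bil0r (ract_bilinear lraP)) (scal0 (reprfun_lin f)).
- have := representative_lin c (IHu f) (IHw f).
  by congr representative; apply/funext => v; rewrite (rabr v) reprfun_lin.
- have := reprfunP f; congr representative; apply/funext => v.
  by rewrite (ract1r lraP).
- have := representative_ract_Uin (ReprFun (IHu f)) x.
  by congr representative; apply/funext => v; rewrite (ractM lraP).
Qed.

Definition repr_act (u : A) (f : R) : R := ReprFun (representative_ract f u).

Lemma repr_actE u f v : repr_act u f v = f (ra v u).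
Proof. by []. Qed.

Lemma coact_ex u : exists t : tens A R, forall v, rev v t = la v u.
Proof.
elim/Uenv_ind: u => [|c u w [s sE] [t tE]||x u [t tE]].
- by exists 0 => v; rewrite (lin0 (@rev_lin _ _ _ v)) (lin0 (labr v)).
- by exists (c *: s + t) => v; rewrite (@rev_lin _ _ _ v) sE tE (labr v).
- by exists (1 ⊗ 1) => v; rewrite rev_pure (lact1r lraP).
- have [n [c [y cE]]] := la_fin x.
  (* The two summands are what the product rule for the coaction prescribes at the primitive element
     [x]. *)
  exists ((\sum_(j < n) y j ⊗ c j) * t + \sw_(b, h <- t) (b ⊗ repr_act (Uin x) h)) => v.
  rewrite (linD (@rev_lin _ _ _ v)) (rev_comp _ _ (repr_actE (Uin x))) tE rev_mul lact_Uin_mul; congr (_ + _).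
  apply: eq_swd => v1 v2; rewrite tE cE (lin_sum (@rev_lin _ _ _ v1)).
  by congr (_ * _); apply: eq_bigr => j _; rewrite rev_pure.
Qed.

End RepresentativeActions.

(** * Verification of the axioms by evaluation *)

Section HopfMatchedPair.
Variables (K : fieldType) (g1 g2 : lieAlgType K).
Local Notation A := (Uenv g1).
Local Notation B := (Uenv g2).
Local Notation R := (reprfun g2).
Variables (la : B -> A -> A) (ra : B -> A -> B).
Hypothesis lraP : matched_actions la ra.
Variables (act : A -> R -> R) (coact : A -> tens A R).
Hypothesis actE : forall u f v, act u f v = f (ra v u).
Hypothesis coactE : forall u v, rev v (coact u) = la v u.

Let labl u := (lact_bilinear lraP).1 u.
Let labr v := (lact_bilinear lraP).2 v.
Let rabl u := (ract_bilinear lraP).1 u.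
Let rabr v := (ract_bilinear lraP).2 v.
Let revl V v := @rev_lin K g2 V v.

Lemma canonical_act_bilin : is_bilinear act.
Proof.
split=> [f|u] c x y; apply: reprfun_ext => v; last by rewrite reprfunED reprfunEZ !actE.
by rewrite reprfunED reprfunEZ !actE (rabr v) reprfun_lin.
Qed.

Lemma canonical_coact_lin : linear coact.
Proof.
by move=> c u w; apply: rev_inj => v; rewrite (revl v) !coactE (labr v).
Qed.

(** Evaluated at [v], the axioms say that ◁ is a right action and a coalgebra map. *)
Lemma canonical_module_algebra : is_module_algebra act.
Proof.
split; first exact: canonical_act_bilin.
- by move=> f; apply: reprfun_ext => v; rewrite actE (ract1r lraP).
- by move=> u w f; apply: reprfun_ext => v; rewrite !actE (ractM lraP).
- move=> u; apply: reprfun_ext => v; rewrite actE reprfunEZ !reprfunE1.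
  by rewrite (ract_counit lraP) mulrC.
- move=> u f h; apply: reprfun_ext => v; rewrite actE reprfunEM (ract_comul lraP).
  have bfh := mulK_bilinear (reprfun_lin f) (reprfun_lin h).
  have ll := swd_linear bfh.
  rewrite (lin_swd _ _ ll); under eq_swd do rewrite (lin_swd _ _ ll).
  rewrite swd_exchange (lin_swd (f := fun f : R => f v : K^o)) //.
  apply: (eq_swd (Z := K^o)) => u1 u2; rewrite reprfunEM.
  by apply: (eq_swd (Z := K^o)) => v1 v2; rewrite swd_pure // !actE.
Qed.

(** Under evaluation, coassociativity becomes the action law of ▷, with both sides equal to (v w) ▷
    u; the counit axiom becomes 1 ▷ u = u; the last two axioms say that ▷ is a coalgebra map. *)
Lemma canonical_comodule_coalgebra : is_comodule_coalgebra coact.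
Proof.
split; first exact: canonical_coact_lin.
- move=> u; apply: rev_inj => w; apply: rev_inj => v.
  rewrite !(lin_swd _ _ (revl w)) !(lin_swd _ _ (revl v)).
  transitivity (la (v * w) u).
    rewrite (lactM lraP) -(coactE u w) (lin_swd _ _ (labr v)).
    apply: eq_swd => a f.
    by rewrite rev_assoc (linZ (revl v)) (linZ (labr v)) coactE.
  rewrite -coactE; apply: eq_swd => a f.
  rewrite (lin_swd _ _ (revl w)) (lin_swd _ _ (revl v)) -comul_reprE swd_scalel.
  apply: eq_swd => f1 f2.
  by rewrite rev_pure (linZ (revl v)) rev_pure scalerA mulrC.
- by move=> u; apply: etrans (coactE u 1) _; exact: lact1l lraP u.
- move=> u; apply: rev_inj => v.
  have dl := @comul_linear K A.
  transitivity (comul (la v u)).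
    rewrite -coactE (lin_swd _ _ dl) (lin_swd _ _ (revl v)).
    by apply: eq_swd => a f; rewrite rev_assoc (linZ dl).
  rewrite (lact_comul lraP) (lin_swd _ _ (revl v)) swd_exchange.
  apply: eq_swd => u1 u2; rewrite (lin_swd _ _ (revl v)).
  under [RHS]eq_swd do rewrite (lin_swd _ _ (revl v)).
  under [RHS]eq_swd do under eq_swd do rewrite rev_pure.
  rewrite rev_conv; last exact: tpure_bilinear.
  by apply: eq_swd => v1 v2; rewrite !coactE.
- move=> u; apply: reprfun_ext => v; have el := @counit_linear K A.
  rewrite reprfunEZ reprfunE1 mulrC -(lact_counit lraP) -coactE.
  rewrite (lin_swd (f := fun f : R => f v : K^o)) // [RHS](lin_swd (Z' := K^o) _ _ el).
  by apply: (eq_swd (Z := K^o)) => a f; rewrite (scalZ el) mulrC.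
Qed.

Lemma canonical_counit u f : counit (act u f) = counit u * counit f.
Proof. by rewrite !counit_reprE actE (ract1l lraP) (scalZ (reprfun_lin f)). Qed.

(** At v and w the left side is f((v w) ◁ u); expand it by [ractMl] and then by the coproduct of
    [f]. *)
Lemma canonical_comul u f : comul (act u f) =
  \sw_(u1, u2 <- comul u) \sw_(f1, f2 <- comul f) \sw_(a, h <- coact u1)
    (act a f1 ⊗ (h * act u2 f2)).
Proof.
apply: rev_inj => w; apply: reprfun_ext => v.
have evl : linear (fun f : R => f v : K^o) by [].
rewrite rev_comul actE (ractMl lraP) (lin_swd _ _ (reprfun_linear f)).
under eq_swd do rewrite (lin_swd _ _ (reprfun_linear f)).
rewrite swd_exchange (lin_swd _ _ (revl w)) (lin_swd _ _ evl).
apply: (eq_swd (Z := K^o)) => u1 u2.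
rewrite (lin_swd _ _ (revl w)) (lin_swd _ _ evl).
under eq_swd do rewrite -comul_reprE.
rewrite swd_exchange; apply: (eq_swd (Z := K^o)) => f1 f2.
rewrite (lin_swd _ _ (revl w)) (lin_swd _ _ evl).
under [RHS]eq_swd do rewrite rev_pure reprfunEZ reprfunEM actE swd_mulKr.
rewrite swd_exchange; apply: (eq_swd (Z := K^o)) => w1 w2.
rewrite -coactE.
have l1 : linear (fun a => f1 (ra v a) : K^o).
  by move=> c x y; rewrite (rabr v) reprfun_lin.
rewrite (lin_swd _ _ l1) swd_mulKr.
apply: (eq_swd (Z := K^o)) => a h.
by rewrite (linZ (rabr v)) (scalZ (reprfun_lin f1)) actE mulrAC.
Qed.

Lemma canonical_coact1 : coact 1 = 1 ⊗ 1.
Proof. by apply: rev_inj => v; rewrite coactE rev_pure (lact1r lraP). Qed.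

Lemma tens_mul_act u (s t : tens A R) :
  \sw_(a, f <- s) \sw_(b, h <- t) ((a * b) ⊗ (f * act u h)) =
  s * \sw_(b, h <- t) (b ⊗ act u h).
Proof.
rewrite [in RHS](tens_sum s) (lin_swd _ _ (tensmull_lin _)).
apply: eq_swd => a f; rewrite (lin_swd _ _ (tensmulr_lin _)).
by apply: eq_swd => b h; rewrite tensM.
Qed.

(** Evaluation at [v] turns the rule into [lactMr], the coproduct of [v] coming from the convolution
    product. *)
Lemma canonical_coactM : coact_product_rule act coact.
Proof.
move=> u w; apply: rev_inj => v.
rewrite coactE (lactMr lraP) (lin_swd _ _ (revl v)) swd_exchange.
apply: eq_swd => u1 u2; rewrite tens_mul_act rev_mul.
by apply: eq_swd => v1 v2; rewrite (rev_comp _ _ (actE u2)) !coactE.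
Qed.

(** U(g1) is cocommutative and R(g2) is commutative, so both orders can be exchanged. *)
Lemma canonical_compat u f :
  \sw_(u1, u2 <- comul u) \sw_(a, h <- coact u2) (a ⊗ (act u1 f * h)) =
  \sw_(u1, u2 <- comul u) \sw_(a, h <- coact u1) (a ⊗ (h * act u2 f)).
Proof.
have cl := canonical_coact_lin; have [al _] := canonical_act_bilin.
have bG : is_bilinear (fun u1 u2 => \sw_(a, h <- coact u1) (a ⊗ (h * act u2 f))).
  by bilin.
rewrite -[in RHS](comulC u) (lin_swd _ _ (swd_linear bG)).
apply: eq_swd => u1 u2; rewrite swd_pure //.
by apply: eq_swd => a h; rewrite mulrC.
Qed.

Lemma canonical_matched_pair : is_hopf_matched_pair act coact.
Proof.
split; [exact: canonical_module_algebra | exact: canonical_comodule_coalgebra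
  | exact: canonical_counit | exact: canonical_comul | exact: canonical_coact1
  | exact: canonical_coactM | exact: canonical_compat].
Qed.

End HopfMatchedPair.

(** * Coefficient functions and uniqueness of the coaction *)

Section Canonical.
Variables (K : fieldType) (g1 g2 : lieAlgType K) (m : lieMatchedPair g1 g2).
Variables (n : nat) (X : n.-tuple g1).
Hypothesis hX : basis_of fullv X.

(** The coefficients are the coordinates of [lam v x]. They are representative because
    [lam (v * w) x] is determined by the finitely many coordinates of [lam w x]. *)
Lemma Ulact_coefficients x : exists c : 'I_n -> reprfun g2,
  forall v, Ulact m v (Uin x) = \sum_(j < n) c j v *: Uin (tnth X j).
Proof.
have [lam [laml lamM lamE]] := Ulact_Uin m.
have cl j : scalar (fun v => coord X j (lam v x)).
  by move=> c v w; rewrite (laml.1 x) linearP.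
have rc j : representative (fun v => coord X j (lam v x)).
  apply: (representative_translates (p := fun i v => coord X i (lam v x))) => // w wx v.
  rewrite lamM (coord_basis hX (memvf (lam w x))) big1 => [|i _].
    by rewrite (bil0r laml) linear0.
  by rewrite wx scale0r.
exists (fun j => ReprFun (rc j)) => v.
have ul := (Uin_lie_map g1).1.
rewrite lamE {1}(coord_basis hX (memvf (lam v x))) (lin_sum ul).
by apply: eq_bigr => j _; rewrite (linZ ul) -tnth_nth.
Qed.

(** At a primitive [x] the product rule expresses the coaction on [x * u] through its values at [x],
    1 and [u], so the basis determines everything. *)
Lemma coaction_extension_uniq (f : 'I_n -> 'I_n -> reprfun g2) act coact coact' :
  is_bilinear act -> is_coaction_extension X f act coact ->
  is_coaction_extension X f act coact' -> coact' =1 coact.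
Proof.
move=> [al _] [cl c1 cX cM] [dl d1 dX dM].
have E x : coact' (Uin x) = coact (Uin x).
  have ul := (Uin_lie_map g1).1.
  rewrite (coord_basis hX (memvf x)) (lin_sum ul) (lin_sum cl) (lin_sum dl).
  by apply: eq_bigr => i _; rewrite (linZ ul) (linZ cl) (linZ dl) -tnth_nth cX dX.
elim/Uenv_ind => [|c u w IHu IHw||x u IHu].
- by rewrite (lin0 cl) (lin0 dl).
- by rewrite cl dl IHu IHw.
- by rewrite c1 d1.
- rewrite cM dM IHu.
  by rewrite !swd_comulX ?E ?c1 ?d1 //; bilin.
Qed.

Lemma canonical_matched_pair_exists :
  (exists f : 'I_n -> 'I_n -> reprfun g2, is_coaction_matrix m X f) /\
  (forall f : 'I_n -> 'I_n -> reprfun g2, is_coaction_matrix m X f ->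
   exists act : Uenv g1 -> reprfun g2 -> reprfun g2,
   exists coact : Uenv g1 -> tens (Uenv g1) (reprfun g2),
   [/\ is_canonical_action m act,
       is_coaction_extension X f act coact,
       (forall coact', is_coaction_extension X f act coact' -> coact' =1 coact)
     & is_hopf_matched_pair act coact]).
Proof.
split=> [|f fE].
  have [f fE] := choice (fun i => Ulact_coefficients (tnth X i)).
  by exists f => v i; exact: fE.
have lraP := Uenv_matched_actions m.
have la_fin x : exists n (c : 'I_n -> reprfun g2) (y : 'I_n -> Uenv g1),
    forall v, Ulact m v (Uin x) = \sum_(j < n) c j v *: y j.
  have [c cE] := Ulact_coefficients x.
  by exists n, c, (fun j => Uin (tnth X j)).
(* The value is chosen separately for each [u]; linearity in [u] follows afterwards from injectivity
   of evaluation. *)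
have [coact coactE] := choice (coact_ex lraP la_fin).
pose act := repr_act lraP la_fin.
have actE u h v : act u h v = h (Uract m v u) by [].
have cl := canonical_coact_lin lraP coactE.
have ext : is_coaction_extension X f act coact.
  split; [exact: cl | exact (canonical_coact1 lraP coactE)
    | | exact (canonical_coactM lraP actE coactE)].
  (* Evaluated at [v], the prescribed value on a basis vector is the defining equation of [f]. *)
  move=> i; apply: rev_inj => v; rewrite coactE fE (lin_sum (@rev_lin _ _ _ v)).
  by apply: eq_bigr => j _; rewrite rev_pure.
exists act, coact; split=> // [coact' ext'|].
  exact (coaction_extension_uniq (canonical_act_bilin lraP actE) ext ext').
exact (canonical_matched_pair lraP actE coactE).
Qed.

End Canonical.

Theorem theorem2p11 (R : realType) (g1 g2 : lieAlgType R[i])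
    (m : lieMatchedPair g1 g2) (n : nat) (X : n.-tuple g1)
    (hX : basis_of fullv X) :
  (exists f : 'I_n -> 'I_n -> reprfun g2, is_coaction_matrix m X f) /\
  (forall f : 'I_n -> 'I_n -> reprfun g2, is_coaction_matrix m X f ->
   exists act : Uenv g1 -> reprfun g2 -> reprfun g2,
   exists coact : Uenv g1 -> tens (Uenv g1) (reprfun g2),
   [/\ is_canonical_action m act,
       is_coaction_extension X f act coact,
       (forall coact', is_coaction_extension X f act coact' -> coact' =1 coact)
     & is_hopf_matched_pair act coact]).
Proof. exact (canonical_matched_pair_exists m hX). Qed.
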